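(* Let $\phi,A_1,A_2,A_3\in B$ (the Moyal--Weyl algebra), $\mathbf A=(A_1,A_2,A_3)$, and let $A^\omega(\vartheta)=\phi\,dx^0-A_1\,dx^1-A_2\,dx^2-A_3\,dx^3\in\Omega^1(B)$ be the corresponding non-commutative gauge potential, with field strength $F^\omega(\vartheta)=dA^\omega(\vartheta)-i\,A^\omega(\vartheta)\wedge A^\omega(\vartheta)$, and let $\mathbf D,\mathbf H,\mathbf E,\mathbf B$ be the fields defined in the context. Then the geometrical equation (non-commutative Bianchi identity, satisfied by every non-commutative gauge potential) $$dF^\omega(\vartheta)=i\left(A^\omega(\vartheta)\wedge F^\omega(\vartheta)-F^\omega(\vartheta)\wedge A^\omega(\vartheta)\right)$$ is given in coordinates by the non-commutative Gauss law for magnetism and the non-commutative Faraday equation $$\nabla\cdot\mathbf H=\rho^m,\qquad\nabla\times\mathbf D+\frac{\partial\mathbf H}{\partial x^0}=-\mathbf j^m,$$ where $$\rho^m:=i[\mathbf B,\mathbf A],\qquad-\mathbf j^m:=i[\phi,\mathbf B]-i(\mathbf E\times\mathbf A+\mathbf A\times\mathbf E).$$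
   Context: Fix an antisymmetric $4\times4$ matrix $(\theta^{\mu\nu})$; its entries are treated as formal central parameters fixed by complex conjugation. $B=C^\infty_{\mathbb C}(\mathbb R^4)[[\theta^{\mu\nu}]]$ is the space of formal power series in $\theta^{\mu\nu}$ with coefficients in complex-valued smooth functions of $(x^0,x^1,x^2,x^3)$, with the Moyal product $f\cdot h=m\circ\exp\left(\frac{i\theta^{\mu\nu}}{2}\frac{\partial}{\partial x^\mu}\otimes\frac{\partial}{\partial x^\nu}\right)(f\otimes h)$ ($m$ the pointwise product, $i=\sqrt{-1}$). $\Omega^\bullet(B)=\Omega^\bullet_{\mathbb C}(\mathbb R^4)[[\theta^{\mu\nu}]]$ with the usual differential $d$ and the Moyal product extended via Lie derivatives: $(f\,dx^I)\wedge(h\,dx^J)=(f\cdot h)\,dx^I\wedge dx^J$. Here $\vartheta$ is a basis vector of the one-dimensional quantum dual Lie algebra ${}_{\mathrm{inv}}\Gamma$ of $U(1)$; a non-commutative gauge potential is a linear map $A^\omega:{}_{\mathrm{inv}}\Gamma\to\Omega^1(B)$, determined by $A^\omega(\vartheta)$. Writing $F^\omega(\vartheta)=\sum_{0\le\mu<\nu\le3}F_{\mu\nu}\,dx^\mu\wedge dx^\nu$, one has $F_{0j}=D_j$ for $j=1,2,3$, $F_{12}=-H_3$, $F_{13}=H_2$, $F_{23}=-H_1$, where $$\mathbf D=(D_1,D_2,D_3):=\mathbf E+i[\phi,\mathbf A],\quad\mathbf E:=-\frac{\partial\mathbf A}{\partial x^0}-\nabla\phi,\qquad\mathbf H=(H_1,H_2,H_3):=\mathbf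 B+i\,\mathbf A\times\mathbf A,\quad\mathbf B:=\nabla\times\mathbf A.$$ All products are Moyal products. $\nabla$ is the gradient in $x^1,x^2,x^3$. For $f\in B$ and triples $\mathbf U,\mathbf V\in B^3$: $[f,\mathbf V]=([f,V_1],[f,V_2],[f,V_3])$ with $[f,h]=f\cdot h-h\cdot f$; $[\mathbf U,\mathbf V]=\sum_{j=1}^3[U_j,V_j]$; $(\mathbf U\times\mathbf V)_1=U_2\cdot V_3-U_3\cdot V_2$ and cyclically (factors ordered with the entry of $\mathbf U$ first). *)

(* Defs.v *)
From HB Require Import structures.
From mathcomp Require Import all_boot all_order all_algebra.
From mathcomp Require Import complex.
From mathcomp Require Import all_classical all_reals all_analysis.

Set Implicit Arguments.
Unset Strict Implicit.
Unset Printing Implicit Defensive.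

Import Order.TTheory GRing.Theory Num.Theory numFieldNormedType.Exports.

Local Open Scope ring_scope.
Local Open Scope complex_scope.

Section RealSmooth.
Context {R : realType}.
Implicit Types g h : 'rV[R]_4 -> R.

Definition coord_dir (mu : 'I_4) : 'rV[R]_4 := delta_mx 0 mu.

Fixpoint is_Cn (n : nat) g : Prop :=
  continuous g /\
  (if n is m.+1 then
     forall mu, (forall x, derivable g x (coord_dir mu)) /\
                is_Cn m (fun x => 'D_(coord_dir mu) g x)
   else True).

Lemma is_Cn_cont n g : is_Cn n g -> continuous g.
Proof. by case: n => [|n] []. Qed.

Lemma is_CnS n g : is_Cn n.+1 g -> is_Cn n g.
Proof.
elim: n g => [|n IH] g [gc gd]; split=> // mu.
by have [dg Cg] := gd mu; split=> //; exact: IH.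
Qed.

Lemma is_Cn_cst n (c : R) : is_Cn n (fun=> c).
Proof.
elim: n c => [|n IH] c; split => //; try by move=> x; exact: cst_continuous.
move=> mu; split; first by move=> x; exact: derivable_cst.
by under eq_fun do rewrite derive_cst.
Qed.

Lemma is_CnD n g h : is_Cn n g -> is_Cn n h -> is_Cn n (g \+ h).
Proof.
elim: n g h => [|n IH] g h [gc gd] [hc hd].
  by split=> // x; apply: continuousD; [exact: gc|exact: hc].
split; first by move=> x; apply: continuousD; [exact: gc|exact: hc].
move=> mu; have [dg Cg] := gd mu; have [dh Ch] := hd mu.
split; first by move=> x; apply: derivableD.
have -> : (fun x => 'D_(coord_dir mu) (g \+ h) x) =
    (fun x => 'D_(coord_dir mu) g x) \+ (fun x => 'D_(coord_dir mu) h x).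
  by apply/funext => x /=; rewrite deriveD.
exact: IH.
Qed.

Lemma is_CnM n g h : is_Cn n g -> is_Cn n h -> is_Cn n (g \* h).
Proof.
elim: n g h => [|n IH] g h Cg0 Ch0.
  by split=> // x; apply: continuousM;
    [exact: (is_Cn_cont Cg0)|exact: (is_Cn_cont Ch0)].
have [gc gd] := Cg0; have [hc hd] := Ch0.
split; first by move=> x; apply: continuousM; [exact: gc|exact: hc].
move=> mu; have [dg Cg] := gd mu; have [dh Ch] := hd mu.
split; first by move=> x; apply: derivableM.
have -> : (fun x => 'D_(coord_dir mu) (g \* h) x) =
    (g \* (fun x => 'D_(coord_dir mu) h x)) \+
    (h \* (fun x => 'D_(coord_dir mu) g x)).
  by apply/funext => x /=; rewrite deriveM.
by apply: is_CnD; apply: IH => //; exact: is_CnS.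
Qed.

Lemma is_CnN n g : is_Cn n g -> is_Cn n (\- g).
Proof.
move=> Cg; have -> : \- g = (fun=> -1) \* g.
  by apply/funext => x /=; rewrite mulN1r.
exact: is_CnM (is_Cn_cst n _) Cg.
Qed.

End RealSmooth.

Section ComplexSmooth.
Context {R : realType}.
Implicit Types f h : 'rV[R]_4 -> R[i].

Definition smooth : {pred 'rV[R]_4 -> R[i]} :=
  mem [set f : 'rV[R]_4 -> R[i] | forall n,
         is_Cn n (fun x => complex.Re (f x)) /\ is_Cn n (fun x => complex.Im (f x))]%classic.

Definition cpartial (mu : 'I_4) f : 'rV[R]_4 -> R[i] := fun x =>
  'D_(coord_dir mu) (fun y => complex.Re (f y)) x +i*
  'D_(coord_dir mu) (fun y => complex.Im (f y)) x.

Lemma smoothP f : reflect (forall n, is_Cn n (fun x => complex.Re (f x)) /\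
  is_Cn n (fun x => complex.Im (f x))) (f \in smooth).
Proof. by apply: (iffP idP); rewrite inE. Qed.

Lemma smooth_cst (c : R[i]) : cst c \in smooth.
Proof. by apply/smoothP => n; split; exact: is_Cn_cst. Qed.

Lemma smoothB f h : f \in smooth -> h \in smooth -> f - h \in smooth.
Proof.
move=> /smoothP sf /smoothP sh; apply/smoothP => n.
have [fr fi] := sf n; have [hr hi] := sh n; split.
- have -> : (fun x => complex.Re ((f - h) x)) =
      (fun x => complex.Re (f x)) \+ (\- (fun x => complex.Re (h x))).
    by apply/funext => x; rewrite !fctE /=; case: (f x) (h x) => [a b] [c d].
  by apply: is_CnD => //; exact: is_CnN.
- have -> : (fun x => complex.Im ((f - h) x)) =
      (fun x => complex.Im (f x)) \+ (\- (fun x => complex.Im (h x))).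
    by apply/funext => x; rewrite !fctE /=; case: (f x) (h x) => [a b] [c d].
  by apply: is_CnD => //; exact: is_CnN.
Qed.

Lemma smoothM f h : f \in smooth -> h \in smooth -> f * h \in smooth.
Proof.
move=> /smoothP sf /smoothP sh; apply/smoothP => n.
have [fr fi] := sf n; have [hr hi] := sh n; split.
- have -> : (fun x => complex.Re ((f * h) x)) =
      ((fun x => complex.Re (f x)) \* (fun x => complex.Re (h x))) \+
      (\- ((fun x => complex.Im (f x)) \* (fun x => complex.Im (h x)))).
    by apply/funext => x; rewrite !fctE /=; case: (f x) (h x) => [a b] [c d].
  by apply: is_CnD; [exact: is_CnM|apply: is_CnN; exact: is_CnM].
- have -> : (fun x => complex.Im ((f * h) x)) =
      ((fun x => complex.Re (f x)) \* (fun x => complex.Im (h x))) \+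
      ((fun x => complex.Im (f x)) \* (fun x => complex.Re (h x))).
    by apply/funext => x; rewrite !fctE /=; case: (f x) (h x) => [a b] [c d].
  by apply: is_CnD; exact: is_CnM.
Qed.

Lemma smooth_subring_closed : subring_closed smooth.
Proof. by split; [exact: smooth_cst|exact: smoothB|exact: smoothM]. Qed.

HB.instance Definition _ := GRing.isSubringClosed.Build _ smooth
  smooth_subring_closed.

Lemma smooth_scaler_closed : scaler_closed smooth.
Proof. by move=> c f; exact: smoothM (smooth_cst c). Qed.

HB.instance Definition _ := GRing.isScaleClosed.Build _ _ smooth
  smooth_scaler_closed.

Lemma smooth_cpartial mu f : f \in smooth -> cpartial mu f \in smooth.
Proof.
move=> /smoothP sf; apply/smoothP => n.
by have [[_ fr] [_ fi]] := sf n.+1; split; [case: (fr mu)|case: (fi mu)].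
Qed.

End ComplexSmooth.

(* C^oo_C(R^4), with pointwise operations *)
Record smooth_fun (R : realType) := SmoothFun {
  smooth_val :> 'rV[R]_4 -> R[i];
  smooth_valP : smooth_val \in smooth }.

Section SmoothFunInstances.
Variable R : realType.
HB.instance Definition _ := [isSub for @smooth_val R].
HB.instance Definition _ := [Choice of smooth_fun R by <:].
HB.instance Definition _ := [SubChoice_isSubComNzRing of smooth_fun R by <:].
HB.instance Definition _ := [SubZmodule_isSubLmodule of smooth_fun R by <:].
End SmoothFunInstances.

Definition partial_smooth (R : realType) (mu : 'I_4) (f : smooth_fun R) :
    smooth_fun R :=
  SmoothFun (smooth_cpartial mu (smooth_valP f)).

(* The matrix (theta^{mu nu}) is antisymmetric, so the independent formal
   parameters are the theta^{mu nu} with mu < nu. *)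
Definition theta_idx := {p : 'I_4 * 'I_4 | (p.1 < p.2)%N}.

Definition theta_exp := {ffun theta_idx -> nat}.

Definition theta_deg (K : theta_exp) : nat := (\sum_p K p)%N.

(* B = C^oo_C(R^4)[[theta^{mu nu}]]; f K is the coefficient of theta^K. *)
Definition moyal_alg (R : realType) : Type := theta_exp -> smooth_fun R.

HB.instance Definition _ (R : realType) :=
  GRing.Lmodule.copy (moyal_alg R) (theta_exp -> smooth_fun R).

Section MoyalProduct.
Context {R : realType}.
Implicit Types f h : moyal_alg R.

Definition partial (mu : 'I_4) f : moyal_alg R :=
  fun K => partial_smooth mu (f K).

(* Commutative product of power series (pointwise on coefficients): the
   theta^K-coefficient is the sum over all L <= K of f_L h_(K - L). *)
Definition ps_mul f h : moyal_alg R := fun K =>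
  \sum_(L : {ffun theta_idx -> 'I_(theta_deg K).+1} | [forall p, L p <= K p]%N)
    f [ffun p => L p : nat] * h [ffun p => (K p - L p)%N].

Definition theta_var (p : theta_idx) : moyal_alg R := fun K =>
  if K == [ffun q => (q == p) : nat] then 1 else 0.

Definition theta (mu nu : 'I_4) : moyal_alg R :=
  if insub (mu, nu) is Some p then theta_var p
  else if insub (nu, mu) is Some p then - theta_var p
  else 0.

(* m ((i theta^{mu nu} / 2 d_mu (x) d_nu)^n (f (x) h)) *)
Fixpoint moyal_term (n : nat) f h : moyal_alg R :=
  if n is n'.+1 then
    \sum_(mu < 4) \sum_(nu < 4)
      ('i / 2) *: ps_mul (theta mu nu)
                         (moyal_term n' (partial mu f) (partial nu h))
  else ps_mul f h.

(* Moyal product.  The n-th term of the exponential series is divisible by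
   theta-monomials of degree n, so only the terms with n <= |K| contribute
   to the coefficient of theta^K. *)
Definition moyal_mul f h : moyal_alg R := fun K =>
  \sum_(n < (theta_deg K).+1) (n`!%:R)^-1 *: moyal_term n f h K.

Definition moyal_comm f h : moyal_alg R := moyal_mul f h - moyal_mul h f.

End MoyalProduct.

(* Omega^k(B): the component of a form at I is the coefficient of
   dx^I = dx^{i_1} /\ ... /\ dx^{i_k}, i_1 < ... < i_k the elements of I. *)
Definition form_idx (k : nat) := {I : {set 'I_4} | #|I| == k}.

Definition Omega (R : realType) (k : nat) : Type := form_idx k -> moyal_alg R.

HB.instance Definition _ (R : realType) (k : nat) :=
  GRing.Lmodule.copy (Omega R k) (form_idx k -> moyal_alg R).

Section Forms.
Context {R : realType}.

(* f dx^S as a k-form; it is 0 when #|S| <> k. *)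
Definition monomial_form k (f : moyal_alg R) (S : {set 'I_4}) : Omega R k :=
  fun I => if val I == S then f else 0.

(* For disjoint I and J, dx^I /\ dx^J = shuffle_sign I J dx^(I :|: J). *)
Definition shuffle_sign (I J : {set 'I_4}) : R[i] :=
  (-1) ^+ #|[set p : 'I_4 * 'I_4 | [&& p.1 \in I, p.2 \in J & p.2 < p.1]%N]|.

(* Lie derivatives along the d/dx^mu annihilate the dx^I, hence
   (f dx^I) /\ (h dx^J) = (f . h) dx^I /\ dx^J with the Moyal product f . h. *)
Definition wedge k l (a : Omega R k) (b : Omega R l) : Omega R (k + l) := fun K =>
  \sum_(I : form_idx k)
    \sum_(J : form_idx l | [disjoint val I & val J]
                           && (val I :|: val J == val K))
      shuffle_sign (val I) (val J) *: moyal_mul (a I) (b J).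

Definition ext_d k (a : Omega R k) : Omega R k.+1 := fun K =>
  \sum_(mu < 4)
    \sum_(I : form_idx k | (mu \notin val I) && (mu |: val I == val K))
      shuffle_sign [set mu] (val I) *: partial mu (a I).

Definition field_strength (a : Omega R 1) : Omega R 2 :=
  ext_d a - 'i *: wedge a a.

(* A triple (V_1, V_2, V_3) is indexed by 'I_3: V_(j+1) is V j, and it goes
   with the coordinate x^(j+1) of R^4. *)
Definition space_idx (j : 'I_3) : 'I_4 := lift ord0 j.

Implicit Types (f phi : moyal_alg R) (U V A : 'I_3 -> moyal_alg R).

Definition grad f : 'I_3 -> moyal_alg R := fun j => partial (space_idx j) f.

Definition divergence V : moyal_alg R := \sum_j partial (space_idx j) (V j).

(* Addition in 'I_3 is modulo 3. *)
Definition curl V : 'I_3 -> moyal_alg R := fun j =>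
  partial (space_idx (j + 1)) (V (j + 2)) -
  partial (space_idx (j + 2)) (V (j + 1)).

Definition time_deriv V : 'I_3 -> moyal_alg R := fun j => partial 0 (V j).

Definition cross U V : 'I_3 -> moyal_alg R := fun j =>
  moyal_mul (U (j + 1)) (V (j + 2)) - moyal_mul (U (j + 2)) (V (j + 1)).

Definition comm_scal_vec f V : 'I_3 -> moyal_alg R :=
  fun j => moyal_comm f (V j).

Definition comm_vec U V : moyal_alg R := \sum_j moyal_comm (U j) (V j).

Definition potential_form phi A : Omega R 1 :=
  monomial_form phi [set 0] -
  \sum_j monomial_form (A j) [set space_idx j].

Definition E_field phi A : 'I_3 -> moyal_alg R := - time_deriv A - grad phi.

Definition D_field phi A : 'I_3 -> moyal_alg R :=
  E_field phi A + 'i *: comm_scal_vec phi A.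

Definition B_field A : 'I_3 -> moyal_alg R := curl A.

Definition H_field A : 'I_3 -> moyal_alg R := B_field A + 'i *: cross A A.

Definition magnetic_charge A : moyal_alg R := 'i *: comm_vec (B_field A) A.

Definition magnetic_current phi A : 'I_3 -> moyal_alg R :=
  - ('i *: comm_scal_vec phi (B_field A) -
     'i *: (cross (E_field phi A) A + cross A (E_field phi A))).

(* f dx^1 dx^2 dx^3 + V_1 dx^0 dx^2 dx^3 + V_2 dx^0 dx^3 dx^1
   + V_3 dx^0 dx^1 dx^2; the sign comes from dx^3 dx^1 = - dx^1 dx^3. *)
Definition three_form f V : Omega R 3 :=
  monomial_form f [set 1; 2; 3] + monomial_form (V 0) [set 0; 2; 3]
  - monomial_form (V 1) [set 0; 1; 3] + monomial_form (V 2) [set 0; 1; 2].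

End Forms.

(* Main.v *)
Require Import Defs.
From mathcomp Require Import all_boot all_order all_algebra.
From mathcomp Require Import complex.
From mathcomp Require Import all_classical all_reals all_analysis.
From mathcomp Require Import ring zify.

Set Implicit Arguments.
Unset Strict Implicit.
Unset Printing Implicit Defensive.

Import Order.TTheory GRing.Theory Num.Theory numFieldNormedType.Exports.
Local Open Scope ring_scope.
Local Open Scope complex_scope.

(** Everything rests on four properties of the Moyal product: it is bilinear,
    it is associative, the partial derivatives are derivations of it, and they
    commute with each other.  Given these, with [x, y] = x . y - y . x and
    F_(mu nu) = d_mu a_nu - d_nu a_mu - i [a_mu, a_nu], the coefficient of
    dx^i dx^j dx^k in the Bianchi identity is a cyclic sum in which the second
    derivatives cancel by symmetry, the terms with one derivative match by the
    Leibniz rule, and the cubic terms cancel by associativity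
    ([derivation_bianchi], [bianchi_identity]).

    On the coordinate side, dF is linear in F.  Substituting F_(0j) = D_j and
    F_(jk) = -H_l for (j, k, l) cyclic turns its four coefficients into those
    of minus the form built from div H and curl D + d_0 H
    ([ext_d_field_strength]).  The Leibniz rule and the symmetry of second
    derivatives give div H = rho^m and curl D + d_0 H = - j^m
    ([gauss_magnetic], [faraday]).  The coordinate expression of the right-hand
    side of the Bianchi identity then follows from that of the left-hand side,
    and the equivalence holds because both of its sides are true.

    Commutation of the partial derivatives is the symmetry of mixed second
    derivatives ([derive_comm]), proved by applying the mean value theorem
    twice to a second difference.

    Associativity ([moyal_mulA]) is the usual exponential argument.  The n-th
    term of f . h is m (P^n (f (x) h)), with P the bidifferential operator
    (i/2) theta^(mu nu) d_mu (x) d_nu.  Let P12, P13, P23 be P acting on two of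
    the factors of f (x) g (x) h.  By the Leibniz rule the (a, b) term of
    (f . g) . h is (P13 + P23)^a P12^b and that of f . (g . h) is
    (P12 + P13)^a P23^b, up to the factor 1 / (a! b!).  The three operators
    commute, so by the binomial theorem both double sums become
    sum_n (P12 + P13 + P23)^n / n!.  Tensors are avoided by letting the P's act
    on functions of a triple ([twist]), and convergence is the theta-adic one:
    the n-th term has order at least n in theta ([order_ge_moyal_term]), so
    each coefficient only sees finite sums. *)

(** * Symmetry of second derivatives *)

Section MixedDerivatives.
Context {R : realType} {V : normedModType R}.
Implicit Types (g : V -> R) (u v x : V).

(** Directional derivatives are ordinary derivatives along a line, which makes
    the one-variable mean value theorem available. *)
Lemma is_derive_line g u x (s : R) : derivable g (x + s *: u) u ->
  is_derive s (1 : R) (fun t : R => g (x + t *: u)) ('D_u g (x + s *: u)).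
Proof.
have quotE : (fun h : R => h^-1 *: (((fun t => g (x + t *: u)) \o shift s) (h *: 1)
      - g (x + s *: u))) =
    (fun h : R => h^-1 *: ((g \o shift (x + s *: u)) (h *: u) - g (x + s *: u))).
  apply/funext => h /=; congr (_ *: (g _ - _)).
  by rewrite [h *: 1]mulr1 scalerDl addrCA.
by move=> dg; split; rewrite /derivable /derive quotE.
Qed.

Lemma derivable_line_increment g u x (h : R) : 0 < h ->
  (forall y, derivable g y u) ->
  exists2 s : R, 0 < s < h & g (x + h *: u) - g x = h * 'D_u g (x + s *: u).
Proof.
move=> h0 dg.
have dline (s : R) := is_derive_line (dg (x + s *: u)).
have [|s] := @MVT R (fun t => g (x + t *: u)) (fun t => 'D_u g (x + t *: u)) 0 h h0.
- apply: continuous_subspaceT => t.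
  by apply/differentiable_continuous/derivable1_diffP; have [] := dline t.
by rewrite in_itv /= scale0r addr0 subr0 => sh e; exists s => //; rewrite e mulrC.
Qed.

(** The mean value theorem in the direction u, applied to y |-> g (y + h v) - g y,
    followed by the mean value theorem in the direction v, applied to 'D_u g.
    The left-hand side is symmetric in u and v while the right-hand side is a
    value of 'D_v 'D_u g close to x: this is the source of [derive_comm]. *)
Lemma second_difference g u v x (h : R) : 0 < h ->
  (forall y, derivable g y u) -> (forall y, derivable ('D_u g) y v) ->
  exists s t : R, [/\ 0 < s < h, 0 < t < h &
    g (x + h *: u + h *: v) - g (x + h *: u) - (g (x + h *: v) - g x) =
    h * (h * 'D_v ('D_u g) (x + s *: u + t *: v))].
Proof.
move=> h0 du dv.
pose k y := g (y + h *: v) - g y.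
have shiftE y : (fun c : R => c^-1 *: (((fun z => g (z + h *: v)) \o shift y) (c *: u)
     - g (y + h *: v))) =
   (fun c : R => c^-1 *: ((g \o shift (y + h *: v)) (c *: u) - g (y + h *: v))).
  by apply/funext => c /=; rewrite -addrA.
have dsh y : derivable (fun z => g (z + h *: v)) y u.
  by rewrite /derivable shiftE; exact: du.
have Dsh y : 'D_u (fun z => g (z + h *: v)) y = 'D_u g (y + h *: v).
  by rewrite {1}/derive shiftE.
have [s sh ks] : exists2 s : R, 0 < s < h &
    k (x + h *: u) - k x = h * 'D_u k (x + s *: u).
  by apply: (derivable_line_increment _ h0) => y; apply: derivableB (dsh y) (du y).
have [t th kt] := derivable_line_increment (x + s *: u) h0 dv.
exists s, t; split=> //.
by rewrite -kt -(Dsh (x + s *: u)) -deriveB // -[RHS]ks /k [x + _ + _]addrAC.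
Qed.

(** If the two mixed derivatives differed by e > 0 at x, then for a small step h
    both would be within e / 2 of a common value, namely the second difference
    divided by h ^ 2. *)
Lemma derive_comm g u v :
  (forall y, derivable g y u) -> (forall y, derivable g y v) ->
  (forall y, derivable ('D_u g) y v) -> (forall y, derivable ('D_v g) y u) ->
  continuous ('D_v ('D_u g)) -> continuous ('D_u ('D_v g)) ->
  'D_v ('D_u g) = 'D_u ('D_v g).
Proof.
move=> du dv duv dvu cuv cvu; apply/funext => x.
apply/eqP; rewrite -subr_eq0 -normr_eq0; apply/negPn/negP => ne0.
set e : R := `|_| in ne0.
have e2 : 0 < e / 2 by rewrite divr_gt0 // lt_def ne0 /e normr_ge0.
have /cvgrPdist_lt /(_ _ e2) /nbhs_ballP [r1 /= r10 near1] := cuv x.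
have /cvgrPdist_lt /(_ _ e2) /nbhs_ballP [r2 /= r20 near2] := cvu x.
(* The 1 in M makes it positive even when u = v = 0. *)
pose r := Num.min r1 r2; pose M := `|u| + `|v| + 1.
have r0 : 0 < r by rewrite lt_min r10 r20.
have M0 : 0 < M by rewrite ltr_wpDl // addr_ge0.
pose h := r / M.
have h0 : 0 < h by rewrite divr_gt0.
have small (s t : R) : 0 < s < h -> 0 < t < h -> `|s *: u + t *: v| < r.
  move=> /andP[s0 sh] /andP[t0 th].
  apply: (@le_lt_trans _ _ (h * (`|u| + `|v|))).
    apply: le_trans (ler_normD _ _) _.
    by rewrite !normrZ !gtr0_norm // mulrDr lerD // ler_wpM2r // ltW.
  rewrite -[ltRHS](@divfK _ M) ?gt_eqF // -/h ltr_pM2l //.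
  by rewrite /M ltrDl.
have [s [t [sh th E]]] := second_difference x h0 du duv.
have [t' [s' [th' sh' E']]] := second_difference x h0 dv dvu.
have ball_in (y z w : V) d : `|z + w| < d -> ball y d (y + z + w).
  by rewrite -ball_normE /= distrC -(addrA y) [y + _]addrC addrK.
have lt1 : `|'D_v ('D_u g) x - 'D_v ('D_u g) (x + s *: u + t *: v)| < e / 2.
  apply: near1; apply: ball_in; apply: lt_le_trans (small _ _ sh th) _.
  by rewrite /r ge_min lexx.
have lt2 : `|'D_u ('D_v g) x - 'D_u ('D_v g) (x + t' *: v + s' *: u)| < e / 2.
  apply: near2; apply: ball_in; rewrite addrC.
  by apply: lt_le_trans (small _ _ sh' th') _; rewrite /r ge_min lexx orbT.
have eqD : 'D_v ('D_u g) (x + s *: u + t *: v) = 'D_u ('D_v g) (x + t' *: v + s' *: u).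
  apply: (mulfI (lt0r_neq0 h0)); apply: (mulfI (lt0r_neq0 h0)).
  apply: etrans (esym E) (etrans _ E').
  rewrite [x + h *: v + h *: u]addrAC.
  have swap (a b c d : R) : a - b - (c - d) = a - c - (b - d) by ring.
  exact: swap.
have : e < e / 2 + e / 2.
  rewrite {1}/e -(subrKA ('D_v ('D_u g) (x + s *: u + t *: v))).
  apply: le_lt_trans (ler_normD _ _) _.
  by apply: ltrD; [exact: lt1|rewrite distrC eqD; exact: lt2].
by rewrite -splitr ltxx.
Qed.

End MixedDerivatives.

(** * Partial derivatives of complex-valued smooth functions *)

Section SmoothDerivations.
Context {R : realType}.
Implicit Types (f g : smooth_fun R) (mu nu : 'I_4) (x : 'rV[R]_4) (c : R[i]).

Lemma smooth_is_Cn f n : is_Cn n (fun x => complex.Re (f x)) /\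
  is_Cn n (fun x => complex.Im (f x)).
Proof. by have /smoothP := smooth_valP f. Qed.

Lemma smooth_derivable f mu x :
  derivable (fun y => complex.Re (f y)) x (coord_dir mu) /\
  derivable (fun y => complex.Im (f y)) x (coord_dir mu).
Proof.
by have [[_ fr] [_ fi]] := smooth_is_Cn f 1; split; [case: (fr mu)|case: (fi mu)].
Qed.

Lemma smooth_fun_ext f g : (forall x, f x = g x) -> f = g.
Proof. by move=> fg; apply: val_inj; apply/funext. Qed.

Lemma smooth_funDE f g x : (f + g) x = f x + g x.
Proof. by []. Qed.

Lemma smooth_funME f g x : (f * g) x = f x * g x.
Proof. by []. Qed.

Lemma smooth_funZE c f x : (c *: f) x = c * f x.
Proof. by []. Qed.

Lemma partial_smoothE mu f x : partial_smooth mu f x =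
  'D_(coord_dir mu) (fun y => complex.Re (f y)) x +i*
  'D_(coord_dir mu) (fun y => complex.Im (f y)) x.
Proof. by []. Qed.

Definition re_part f x : R := complex.Re (f x).
Definition im_part f x : R := complex.Im (f x).

Lemma smooth_fun_ext_parts f g :
  re_part f = re_part g -> im_part f = im_part g -> f = g.
Proof.
move=> fgr fgi; apply: smooth_fun_ext => x.
move: (congr1 (@^~ x) fgr) (congr1 (@^~ x) fgi); rewrite /re_part /im_part.
by case: (f x) (g x) => [a b] [c d] /= -> ->.
Qed.

Lemma re_partD f g : re_part (f + g) = re_part f + re_part g.
Proof.
apply/funext => x; rewrite /re_part smooth_funDE fctE.
by case: (f x) (g x) => [a b] [c d].
Qed.

Lemma im_partD f g : im_part (f + g) = im_part f + im_part g.
Proof.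
apply/funext => x; rewrite /im_part smooth_funDE fctE.
by case: (f x) (g x) => [a b] [c d].
Qed.

Lemma re_partM f g :
  re_part (f * g) = re_part f * re_part g - im_part f * im_part g.
Proof.
apply/funext => x; rewrite /re_part /im_part smooth_funME !fctE.
by case: (f x) (g x) => [a b] [c d].
Qed.

Lemma im_partM f g :
  im_part (f * g) = re_part f * im_part g + im_part f * re_part g.
Proof.
apply/funext => x; rewrite /re_part /im_part smooth_funME !fctE.
by case: (f x) (g x) => [a b] [c d].
Qed.

Lemma re_part_partial mu f :
  re_part (partial_smooth mu f) = 'D_(coord_dir mu) (re_part f).
Proof. by []. Qed.

Lemma im_part_partial mu f :
  im_part (partial_smooth mu f) = 'D_(coord_dir mu) (im_part f).
Proof. by []. Qed.

Lemma derivable_re f mu x : derivable (re_part f) x (coord_dir mu).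
Proof. exact: (smooth_derivable f mu x).1. Qed.

Lemma derivable_im f mu x : derivable (im_part f) x (coord_dir mu).
Proof. exact: (smooth_derivable f mu x).2. Qed.

Lemma partial_smoothD mu f g :
  partial_smooth mu (f + g) = partial_smooth mu f + partial_smooth mu g.
Proof.
apply: smooth_fun_ext_parts; apply/funext => x.
  rewrite re_partD !re_part_partial re_partD fctE deriveD //; exact: derivable_re.
rewrite im_partD !im_part_partial im_partD fctE deriveD //; exact: derivable_im.
Qed.

Lemma partial_smoothM mu f g : partial_smooth mu (f * g) =
  partial_smooth mu f * g + f * partial_smooth mu g.
Proof.
have dr := derivable_re; have di := derivable_im.
apply: smooth_fun_ext_parts; apply/funext => x.
  rewrite re_partD !re_partM !re_part_partial !im_part_partial re_partM.
  rewrite deriveB; [|exact: derivableM..].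
  rewrite !deriveM //.
  rewrite !fctE /GRing.scale /=.
  (* Only the ring structure matters from here on. *)
  move: (re_part f x) (re_part g x) (im_part f x) (im_part g x).
  move: ('D__ _ _) ('D__ _ _) ('D__ _ _) ('D__ _ _) => a b c d a' b' c' d'.
  by ring.
rewrite im_partD !im_partM !re_part_partial !im_part_partial im_partM.
rewrite deriveD; [|exact: derivableM..].
rewrite !deriveM //.
rewrite !fctE /GRing.scale /=.
move: (re_part f x) (re_part g x) (im_part f x) (im_part g x).
move: ('D__ _ _) ('D__ _ _) ('D__ _ _) ('D__ _ _) => a b c d a' b' c' d'.
by ring.
Qed.

Lemma partial_smooth_comm mu nu f : partial_smooth mu (partial_smooth nu f) =
  partial_smooth nu (partial_smooth mu f).
Proof.
have cont h : continuous (re_part h) /\ continuous (im_part h).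
  by have [[? _] [? _]] := smooth_is_Cn h 0.
have cr h := (cont h).1; have ci h := (cont h).2.
apply: smooth_fun_ext_parts.
  rewrite !re_part_partial; apply: derive_comm => [y|y|y|y||].
  - exact: derivable_re.
  - exact: derivable_re.
  - exact: (@derivable_re (partial_smooth nu f)).
  - exact: (@derivable_re (partial_smooth mu f)).
  - exact: (cr (partial_smooth mu (partial_smooth nu f))).
  - exact: (cr (partial_smooth nu (partial_smooth mu f))).
rewrite !im_part_partial; apply: derive_comm => [y|y|y|y||].
- exact: derivable_im.
- exact: derivable_im.
- exact: (@derivable_im (partial_smooth nu f)).
- exact: (@derivable_im (partial_smooth mu f)).
- exact: (ci (partial_smooth mu (partial_smooth nu f))).
- exact: (ci (partial_smooth nu (partial_smooth mu f))).
Qed.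

Lemma partial_smoothZ mu c f : partial_smooth mu (c *: f) = c *: partial_smooth mu f.
Proof.
(* Scaling by c is multiplication by a constant, so the Leibniz rule applies. *)
pose k : smooth_fun R := SmoothFun (smooth_cst c).
have kE h : c *: h = k * h by exact: smooth_fun_ext.
have dk : partial_smooth mu k = 0.
  apply: smooth_fun_ext => x; rewrite partial_smoothE.
  transitivity ('D_(coord_dir mu) (fun=> complex.Re c) x +i*
                'D_(coord_dir mu) (fun=> complex.Im c) x); first by [].
  by rewrite !derive_cst.
by rewrite !kE partial_smoothM dk mul0r add0r.
Qed.

End SmoothDerivations.

(** * Exponents of the formal parameters *)

Section ThetaExponents.
Implicit Types (K L M : theta_exp) (p : theta_idx).

Definition exp_le L K := [forall p, (L p <= K p)%N].
Definition exp_add L M : theta_exp := [ffun p => (L p + M p)%N].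
Definition exp_sub K L : theta_exp := [ffun p => (K p - L p)%N].

(** The exponents L <= K as a sequence of elements of [theta_exp]: the index
    type of the sum defining [ps_mul] depends on the degree of K, and sums for
    different K could not be compared or exchanged over such types. *)
Definition exp_below K : seq theta_exp :=
  [seq [ffun p => L p : nat] |
     L : {ffun theta_idx -> 'I_(theta_deg K).+1}
       <- enum {ffun theta_idx -> 'I_(theta_deg K).+1} &
     [forall p, (L p <= K p)%N]].

Lemma exp_leP L K : reflect (forall p, (L p <= K p)%N) (exp_le L K).
Proof. exact: forallP. Qed.

Lemma exp_le_trans L K M : exp_le L K -> exp_le K M -> exp_le L M.
Proof.
by move=> /exp_leP lk /exp_leP km; apply/exp_leP => p; exact: leq_trans (lk p) (km p).
Qed.

Lemma theta_deg_add L M : theta_deg (exp_add L M) = (theta_deg L + theta_deg M)%N.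
Proof. by rewrite /theta_deg -big_split; apply: eq_bigr => p _; rewrite ffunE. Qed.

Lemma exp_subK K L : exp_le L K -> exp_add L (exp_sub K L) = K.
Proof. by move=> /exp_leP lk; apply/ffunP => p; rewrite !ffunE subnKC. Qed.

Lemma exp_addK L M : exp_sub (exp_add L M) L = M.
Proof. by apply/ffunP => p; rewrite !ffunE addKn. Qed.

Lemma exp_sub_le K L : exp_le (exp_sub K L) K.
Proof. by apply/exp_leP => p; rewrite ffunE leq_subr. Qed.

Lemma exp_subKK K L : exp_le L K -> exp_sub K (exp_sub K L) = L.
Proof. by move=> /exp_leP lk; apply/ffunP => p; rewrite !ffunE subKn. Qed.

Lemma exp_sub_add K L M : exp_sub K (exp_add L M) = exp_sub (exp_sub K L) M.
Proof. by apply/ffunP => p; rewrite !ffunE subnDA. Qed.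

Lemma theta_deg_le L K : exp_le L K -> (theta_deg L <= theta_deg K)%N.
Proof. by move=> /exp_leP lk; apply: leq_sum => p _; exact: lk. Qed.

Lemma mem_exp_below K L : (L \in exp_below K) = exp_le L K.
Proof.
apply/mapP/idP => [[M]|lk].
  rewrite mem_filter => /andP[/forallP MK _] ->.
  by apply/exp_leP => p; rewrite ffunE; exact: MK.
have bnd p : (L p < (theta_deg K).+1)%N.
  rewrite ltnS; apply: leq_trans _ (theta_deg_le lk).
  by rewrite /theta_deg (bigD1 p) //= leq_addr.
exists [ffun p => Ordinal (bnd p)]; last by apply/ffunP => p; rewrite !ffunE.
rewrite mem_filter mem_enum andbT; apply/forallP => p.
by rewrite ffunE /=; exact: (exp_leP _ _ lk).
Qed.

Lemma exp_below_uniq K : uniq (exp_below K).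
Proof.
rewrite map_inj_uniq ?filter_uniq -?enumT ?enum_uniq // => L M /ffunP LM.
apply/ffunP => p.
by have := LM p; rewrite !ffunE => /val_inj.
Qed.

Lemma exp_below_sub L K : exp_le L K ->
  perm_eq (exp_below L) [seq M <- exp_below K | exp_le M L].
Proof.
move=> lk; apply: uniq_perm; rewrite ?filter_uniq ?exp_below_uniq // => M.
rewrite mem_filter !mem_exp_below; case ML: (exp_le M L) => //=.
by rewrite (exp_le_trans ML lk).
Qed.

Lemma exp_below_shift L K : exp_le L K ->
  perm_eq [seq M <- exp_below K | exp_le L M]
          [seq exp_add L M | M <- exp_below (exp_sub K L)].
Proof.
move=> lk; apply: uniq_perm; rewrite ?filter_uniq ?exp_below_uniq //.
  rewrite map_inj_uniq ?exp_below_uniq // => M M' eqM.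
  by rewrite -(exp_addK L M) eqM exp_addK.
move=> M; rewrite mem_filter mem_exp_below; apply/andP/mapP => [[LM MK]|[Q]].
  exists (exp_sub M L); last by rewrite exp_subK.
  rewrite mem_exp_below; apply/exp_leP => p; rewrite !ffunE leq_sub2r //.
  exact: (exp_leP _ _ MK).
rewrite mem_exp_below => /exp_leP QK ->; split; apply/exp_leP => p.
  by rewrite ffunE leq_addr.
have := QK p; rewrite !ffunE => Qp.
by rewrite -(subnKC (exp_leP _ _ lk p)) leq_add2l.
Qed.

Lemma exp_below_sym K :
  perm_eq (exp_below K) [seq exp_sub K L | L <- exp_below K].
Proof.
apply: uniq_perm; rewrite ?exp_below_uniq //.
  rewrite map_inj_in_uniq ?exp_below_uniq // => L M.
  rewrite !mem_exp_below => lk mk eqLM.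
  by rewrite -(exp_subKK lk) eqLM exp_subKK.
move=> L; rewrite mem_exp_below; apply/idP/mapP => [lk|[M _ ->]].
  by exists (exp_sub K L); rewrite ?exp_subKK // mem_exp_below exp_sub_le.
exact: exp_sub_le.
Qed.

End ThetaExponents.

(** * Commutative product of power series in the parameters *)

Section PowerSeries.
Context {R : realType}.
Implicit Types (f g h : moyal_alg R) (mu nu : 'I_4) (c : R[i]) (K : theta_exp).

Lemma moyal_algDE f g K : (f + g) K = f K + g K.
Proof. by []. Qed.

Lemma moyal_algZE c f K : (c *: f) K = c *: f K.
Proof. by []. Qed.

Lemma ps_mulE f h K :
  ps_mul f h K = \sum_(L <- exp_below K) f L * h (exp_sub K L).
Proof.
rewrite /ps_mul /exp_below big_map big_filter big_enum_cond /=.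
apply: eq_bigr => L _; congr (_ * h _).
by apply/ffunP => p; rewrite !ffunE.
Qed.

Lemma ps_mulC f h : ps_mul f h = ps_mul h f.
Proof.
apply/funext => K; rewrite !ps_mulE (perm_big _ (exp_below_sym K)) big_map.
apply: eq_big_seq => L; rewrite mem_exp_below => lk.
by rewrite exp_subKK // mulrC.
Qed.

(** Both sides are sums over the exponents P, Q with P + Q <= K; on the left,
    the summation index L of the outer product is P + Q. *)
Lemma ps_mulA f g h : ps_mul (ps_mul f g) h = ps_mul f (ps_mul g h).
Proof.
apply/funext => K; rewrite !ps_mulE.
transitivity (\sum_(L <- exp_below K) \sum_(P <- exp_below K | exp_le P L)
   f P * g (exp_sub L P) * h (exp_sub K L)).
  apply: eq_big_seq => L; rewrite mem_exp_below => lk.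
  by rewrite ps_mulE mulr_suml (perm_big _ (exp_below_sub lk)) big_filter.
rewrite (exchange_big_dep xpredT) //=.
apply: eq_big_seq => P; rewrite mem_exp_below => pk.
rewrite -big_filter (perm_big _ (exp_below_shift pk)) big_map ps_mulE mulr_sumr.
by apply: eq_bigr => Q _; rewrite exp_addK exp_sub_add mulrA.
Qed.

Lemma ps_mulDl f g h : ps_mul (f + g) h = ps_mul f h + ps_mul g h.
Proof.
apply/funext => K; rewrite moyal_algDE !ps_mulE -big_split.
by apply: eq_bigr => L _; rewrite moyal_algDE mulrDl.
Qed.

Lemma ps_mulZl c f h : ps_mul (c *: f) h = c *: ps_mul f h.
Proof.
have scaleAl (u v : smooth_fun R) : (c *: u) * v = c *: (u * v).
  by apply: smooth_fun_ext => x; rewrite smooth_funZE !smooth_funME smooth_funZE mulrA.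
apply/funext => K; rewrite moyal_algZE !ps_mulE scaler_sumr.
by apply: eq_bigr => L _; rewrite moyal_algZE scaleAl.
Qed.

Lemma ps_mulDr f g h : ps_mul f (g + h) = ps_mul f g + ps_mul f h.
Proof. by rewrite ![ps_mul f _]ps_mulC ps_mulDl. Qed.

Lemma ps_mulZr c f h : ps_mul f (c *: h) = c *: ps_mul f h.
Proof. by rewrite ![ps_mul f _]ps_mulC ps_mulZl. Qed.

Lemma ps_mul0l f : ps_mul 0 f = 0.
Proof. by rewrite -[X in ps_mul X f](scale0r (0 : moyal_alg R)) ps_mulZl scale0r. Qed.

Lemma ps_mul0r f : ps_mul f 0 = 0.
Proof. by rewrite ps_mulC ps_mul0l. Qed.

Lemma ps_mul_suml I (r : seq I) (F : I -> moyal_alg R) f :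
  ps_mul (\sum_(i <- r) F i) f = \sum_(i <- r) ps_mul (F i) f.
Proof. exact: (big_morph _ (fun x y => ps_mulDl x y f) (ps_mul0l f)). Qed.

Lemma ps_mul_sumr I (r : seq I) (F : I -> moyal_alg R) f :
  ps_mul f (\sum_(i <- r) F i) = \sum_(i <- r) ps_mul f (F i).
Proof. exact: (big_morph _ (ps_mulDr f) (ps_mul0r f)). Qed.

Lemma partialD mu f g : partial mu (f + g) = partial mu f + partial mu g.
Proof. by apply/funext => K; exact: partial_smoothD. Qed.

Lemma partialZ mu c f : partial mu (c *: f) = c *: partial mu f.
Proof. by apply/funext => K; exact: partial_smoothZ. Qed.

Lemma partial_comm mu nu f :
  partial mu (partial nu f) = partial nu (partial mu f).
Proof. by apply/funext => K; exact: partial_smooth_comm. Qed.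

Lemma partial_ps_mul mu f h : partial mu (ps_mul f h) =
  ps_mul (partial mu f) h + ps_mul f (partial mu h).
Proof.
have d0 : partial_smooth mu 0 = 0 :> smooth_fun R.
  rewrite -[X in partial_smooth _ X](scale0r (0 : smooth_fun R)).
  by rewrite partial_smoothZ scale0r.
apply/funext => K; rewrite moyal_algDE /partial !ps_mulE.
rewrite (big_morph _ (partial_smoothD mu) d0) -big_split.
by apply: eq_bigr => L _; rewrite partial_smoothM.
Qed.

Lemma partial0 mu : partial mu 0 = 0 :> moyal_alg R.
Proof. by rewrite -[X in partial _ X](scale0r (0 : moyal_alg R)) partialZ scale0r. Qed.

(** The parameters are constants: this is what lets the partial derivatives pass
    through the bidifferential operator of the Moyal product. *)
Lemma partial_theta lam mu nu : partial lam (theta mu nu) = 0 :> moyal_alg R.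
Proof.
have d1 : partial_smooth lam 1 = 0 :> smooth_fun R.
  have := partial_smoothM lam 1 (1 : smooth_fun R).
  rewrite !mulr1 mul1r => /(congr1 (fun x => x - partial_smooth lam 1)).
  by rewrite subrr addrK.
have dvar p : partial lam (theta_var p) = 0 :> moyal_alg R.
  apply/funext => K; rewrite /partial /theta_var; case: ifP => _; first exact: d1.
  exact: (congr1 (@^~ K) (partial0 lam)).
rewrite /theta; case: insub => [p|]; first exact: dvar.
case: insub => [p|]; last exact: partial0.
by rewrite -scaleN1r partialZ dvar scaler0.
Qed.

End PowerSeries.

(** * Powers of a sum of commuting operators *)

Section Combinatorics.

(** The binomial theorem in the ring of additive endomorphisms of X, stated with
    iterated functions so that this ring need not be constructed. *)
Lemma iter_binomial (X : zmodType) (U V : X -> X) (x : X) n :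
  {morph U : y z / y + z} -> {morph V : y z / y + z} ->
  (forall y, U (V y) = V (U y)) ->
  iter n (fun y => U y + V y) x =
  \sum_(j < n.+1) iter j U (iter (n - j) V x) *+ 'C(n, j).
Proof.
move=> UD VD UV.
have W0 (W : X -> X) : {morph W : y z / y + z} -> W 0 = 0.
  by move=> WD; apply: (addrI (W 0)); rewrite -WD !addr0.
have WMn (W : X -> X) : {morph W : y z / y + z} -> forall k y, W (y *+ k) = W y *+ k.
  by move=> WD; elim=> [|k IH] y; rewrite ?mulr0n ?W0 // !mulrS WD IH.
have V_iterU j y : V (iter j U y) = iter j U (V y).
  by elim: j => //= j IH; rewrite -UV IH.
elim: n => [|n IH]; first by rewrite big_ord_recl big_ord0 /= addr0 bin0.
rewrite iterS IH (big_morph _ UD (W0 _ UD)) (big_morph _ VD (W0 _ VD)).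
rewrite [RHS]big_ord_recl bin0 subn0 [iter 0 U _]/=.
under [in RHS]eq_bigr => j _ do rewrite lift0 subSS binS mulrnDr.
rewrite big_split /= [LHS]addrC [RHS]addrA; congr (_ + _); last first.
  by apply: eq_bigr => j _; rewrite WMn.
rewrite [in RHS]big_ord_recr /= bin_small // mulr0n addr0.
rewrite [in LHS]big_ord_recl subn0 bin0 WMn //; congr (_ + _).
by apply: eq_bigr => j _; rewrite WMn // lift0 V_iterU -iterS subnSK.
Qed.

Lemma sum_triangle (X : nmodType) (H : nat -> nat -> X) N :
  (forall a b, (N <= a + b)%N -> H a b = 0) ->
  \sum_(a < N) \sum_(b < N) H a b = \sum_(n < N) \sum_(j < n.+1) H j (n - j)%N.
Proof.
move=> H0; symmetry.
transitivity (\sum_(n < N) \sum_(j < N | (j <= n)%N) H j (n - j)%N).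
  apply: eq_bigr => n _.
  by rewrite (big_ord_widen_cond N xpredT (fun j => H j (n - j)%N)) ?ltn_ord.
rewrite (exchange_big_dep xpredT) //=; apply: eq_bigr => j _.
rewrite -(big_mkord (fun n => (j <= n)%N) (fun n => H j (n - j)%N)).
rewrite -(big_nat_widenl j 0 N xpredT) // -{1}[nat_of_ord j]add0n big_addn.
rewrite big_mkord; under [LHS]eq_bigr => b _ do rewrite addnK.
rewrite (big_ord_widen_cond N xpredT (H j)) ?leq_subr //.
rewrite big_mkcond; apply: eq_bigr => b _ /=; case: ltnP => //.
by rewrite leq_subLR => /H0.
Qed.

End Combinatorics.

(** * Terms of the Moyal series *)

Section MoyalTerms.
Context {R : realType}.
Implicit Types (f g h : moyal_alg R) (lam : 'I_4) (m : 'I_4 * 'I_4) (c : R[i]).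

(** Multiplication by the coefficient of the bidifferential operator P. *)
Definition poisson_mul m f : moyal_alg R := ('i / 2) *: ps_mul (theta m.1 m.2) f.

Lemma poisson_mulD m f g : poisson_mul m (f + g) = poisson_mul m f + poisson_mul m g.
Proof. by rewrite /poisson_mul ps_mulDr scalerDr. Qed.

Lemma poisson_mulZ m c f : poisson_mul m (c *: f) = c *: poisson_mul m f.
Proof. by rewrite /poisson_mul ps_mulZr !scalerA mulrC. Qed.

Lemma poisson_mul0 m : poisson_mul m 0 = 0.
Proof. by apply: (addrI (poisson_mul m 0)); rewrite -poisson_mulD !addr0. Qed.

Lemma poisson_mul_sum m I (r : seq I) (F : I -> moyal_alg R) :
  poisson_mul m (\sum_(i <- r) F i) = \sum_(i <- r) poisson_mul m (F i).
Proof. exact: (big_morph _ (poisson_mulD m) (poisson_mul0 m)). Qed.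

Lemma poisson_mulC m m' f :
  poisson_mul m (poisson_mul m' f) = poisson_mul m' (poisson_mul m f).
Proof.
rewrite /poisson_mul !ps_mulZr -!ps_mulA.
by rewrite [ps_mul (theta m.1 m.2) _]ps_mulC.
Qed.

Lemma poisson_mul_mulr m f h : ps_mul (poisson_mul m f) h = poisson_mul m (ps_mul f h).
Proof. by rewrite /poisson_mul ps_mulZl ps_mulA. Qed.

Lemma poisson_mul_mull m f h : ps_mul f (poisson_mul m h) = poisson_mul m (ps_mul f h).
Proof. by rewrite ps_mulC poisson_mul_mulr ps_mulC. Qed.

Lemma partial_poisson_mul lam m f :
  partial lam (poisson_mul m f) = poisson_mul m (partial lam f).
Proof.
rewrite /poisson_mul partialZ partial_ps_mul partial_theta.
by rewrite ps_mul0l add0r.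
Qed.

Lemma moyal_termS n f h : moyal_term n.+1 f h =
  \sum_m poisson_mul m (moyal_term n (partial m.1 f) (partial m.2 h)).
Proof. by rewrite /= pair_big. Qed.

Lemma moyal_termDl n f g h :
  moyal_term n (f + g) h = moyal_term n f h + moyal_term n g h.
Proof.
elim: n f g h => [|n IH] f g h; first exact: ps_mulDl.
rewrite !moyal_termS -big_split; apply: eq_bigr => m _.
by rewrite partialD IH poisson_mulD.
Qed.

Lemma moyal_termDr n f g h :
  moyal_term n f (g + h) = moyal_term n f g + moyal_term n f h.
Proof.
elim: n f g h => [|n IH] f g h; first exact: ps_mulDr.
rewrite !moyal_termS -big_split; apply: eq_bigr => m _.
by rewrite partialD IH poisson_mulD.
Qed.

Lemma moyal_termZl n c f h : moyal_term n (c *: f) h = c *: moyal_term n f h.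
Proof.
elim: n f h => [|n IH] f h; first exact: ps_mulZl.
rewrite !moyal_termS scaler_sumr; apply: eq_bigr => m _.
by rewrite partialZ IH poisson_mulZ.
Qed.

Lemma moyal_termZr n c f h : moyal_term n f (c *: h) = c *: moyal_term n f h.
Proof.
elim: n f h => [|n IH] f h; first exact: ps_mulZr.
rewrite !moyal_termS scaler_sumr; apply: eq_bigr => m _.
by rewrite partialZ IH poisson_mulZ.
Qed.

Lemma partial_moyal_term lam n f h : partial lam (moyal_term n f h) =
  moyal_term n (partial lam f) h + moyal_term n f (partial lam h).
Proof.
elim: n f h => [|n IH] f h; first exact: partial_ps_mul.
rewrite !moyal_termS -big_split (big_morph _ (partialD lam) (partial0 lam)).
apply: eq_bigr => m _; rewrite partial_poisson_mul IH poisson_mulD.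
by rewrite !(partial_comm lam).
Qed.

Section Twist.
Variable T : Type.
Implicit Types (u v : 'I_4 * 'I_4 -> T -> T) (F G : T -> moyal_alg R).

(** The operator P on functions of T: with T a type of pairs or triples and u m
    differentiating two components by d_(m.1) and d_(m.2), this is F |-> F o P
    written without tensor products. *)
Definition twist u F : T -> moyal_alg R := fun t => \sum_m poisson_mul m (F (u m t)).

Lemma twistD u : {morph twist u : F G / F + G}.
Proof.
move=> F G; apply/funext => t; rewrite /twist -[RHS]big_split.
by apply: eq_bigr => m _; exact: poisson_mulD.
Qed.

Lemma twist_comm u v F : (forall m m' t, u m (v m' t) = v m' (u m t)) ->
  twist u (twist v F) = twist v (twist u F).
Proof.
move=> uv; apply/funext => t; rewrite /twist.
under eq_bigr => m _ do rewrite poisson_mul_sum.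
under [RHS]eq_bigr => m _ do rewrite poisson_mul_sum.
rewrite exchange_big; apply: eq_bigr => m' _; apply: eq_bigr => m _.
by rewrite poisson_mulC uv.
Qed.

End Twist.

Local Notation triple := (moyal_alg R * moyal_alg R * moyal_alg R)%type.
Implicit Type t : triple.

Definition deriv12 m t : triple := (partial m.1 t.1.1, partial m.2 t.1.2, t.2).
Definition deriv13 m t : triple := (partial m.1 t.1.1, t.1.2, partial m.2 t.2).
Definition deriv23 m t : triple := (t.1.1, partial m.1 t.1.2, partial m.2 t.2).
Definition triple_mul t : moyal_alg R := ps_mul (ps_mul t.1.1 t.1.2) t.2.

(** Differentiating the factor P^b (f (x) g) by the Leibniz rule spreads each
    outer derivative over f and g, whence the operator P13 + P23. *)
Lemma moyal_term_left a b f g h : moyal_term a (moyal_term b f g) h =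
  iter a (fun F => twist deriv13 F + twist deriv23 F)
    (iter b (twist deriv12) triple_mul) (f, g, h).
Proof.
elim: a f g h => [|a IH] f g h.
  elim: b f g h => [|b IH] f g h //.
  rewrite moyal_termS [RHS]/= /twist [LHS]ps_mul_suml.
  by apply: eq_bigr => m _; rewrite poisson_mul_mulr; congr poisson_mul; exact: IH.
rewrite moyal_termS iterS -[RHS]/(twist deriv13 _ _ + twist deriv23 _ _) -big_split.
apply: eq_bigr => m _.
by rewrite partial_moyal_term moyal_termDl poisson_mulD !IH.
Qed.

Lemma moyal_term_right a b f g h : moyal_term a f (moyal_term b g h) =
  iter a (fun F => twist deriv12 F + twist deriv13 F)
    (iter b (twist deriv23) triple_mul) (f, g, h).
Proof.
elim: a f g h => [|a IH] f g h.
  elim: b f g h => [|b IH] f g h; first by rewrite /= /triple_mul ps_mulA.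
  rewrite moyal_termS [RHS]/= /twist [LHS]ps_mul_sumr.
  by apply: eq_bigr => m _; rewrite poisson_mul_mull; congr poisson_mul; exact: IH.
rewrite moyal_termS iterS -[RHS]/(twist deriv12 _ _ + twist deriv13 _ _) -big_split.
apply: eq_bigr => m _.
by rewrite partial_moyal_term moyal_termDr poisson_mulD !IH.
Qed.

End MoyalTerms.

(** * Associativity of the Moyal product *)

Section MoyalProductTheory.
Context {R : realType}.
Implicit Types (f g h : moyal_alg R) (lam : 'I_4) (m : 'I_4 * 'I_4) (c : R[i]).
Implicit Types (K : theta_exp).

Definition agree_below N f g := forall K, (theta_deg K < N)%N -> f K = g K.
Definition order_ge N f := agree_below N f 0.

Lemma moyal_alg_sumE I (r : seq I) (F : I -> moyal_alg R) K :
  (\sum_(i <- r) F i) K = \sum_(i <- r) F i K.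
Proof. exact: (big_morph (@^~ K)). Qed.

Lemma agree_below_refl N f : agree_below N f f.
Proof. by []. Qed.

Lemma agree_below_ps_mul N f f' h h' : agree_below N f f' -> agree_below N h h' ->
  agree_below N (ps_mul f h) (ps_mul f' h').
Proof.
move=> ff hh K ltK; rewrite !ps_mulE; apply: eq_big_seq => L.
rewrite mem_exp_below => lk; rewrite ff ?hh //; apply: leq_ltn_trans ltK.
  exact: theta_deg_le (exp_sub_le _ _).
exact: theta_deg_le.
Qed.

Lemma agree_below_moyal_term N n f f' h h' : agree_below N f f' -> agree_below N h h' ->
  agree_below N (moyal_term n f h) (moyal_term n f' h').
Proof.
elim: n f f' h h' => [|n IH] f f' h h' ff hh; first exact: agree_below_ps_mul.
move=> K ltK; rewrite !moyal_termS !moyal_alg_sumE; apply: eq_bigr => m _.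
rewrite /poisson_mul !moyal_algZE; congr (_ *: _); apply: agree_below_ps_mul ltK => //.
by apply: IH => L ltL; rewrite /partial ?ff ?hh.
Qed.

Lemma order_ge_ps_mul a b f h : order_ge a f -> order_ge b h ->
  order_ge (a + b) (ps_mul f h).
Proof.
move=> fa hb K ltK; rewrite ps_mulE big_seq big1 // => L; rewrite mem_exp_below => lk.
case: (ltnP (theta_deg L) a) => [/fa -> | aL]; first by rewrite mul0r.
rewrite hb ?mulr0 // -(ltn_add2l (theta_deg L)) -theta_deg_add exp_subK //.
by apply: leq_trans ltK _; rewrite leq_add2r.
Qed.

(** The reason why the Moyal series converges theta-adically. *)
Lemma order_ge_theta mu nu : order_ge 1 (@theta R mu nu).
Proof.
have var p : order_ge 1 (@theta_var R p).
  move=> K; rewrite ltnS leqn0 /theta_var => /eqP K0; case: eqP => // KE.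
  by move: K0; rewrite KE /theta_deg (bigD1 p) //= ffunE eqxx.
move=> K K0; rewrite /theta; case: insub => [p|]; first exact: var.
case: insub => [p|] //; rewrite -scaleN1r moyal_algZE (var p K K0).
exact: scaler0.
Qed.

Lemma order_ge_partial mu a f : order_ge a f -> order_ge a (partial mu f).
Proof.
by move=> fa K /fa fK; rewrite /partial fK; exact: (congr1 (@^~ K) (partial0 mu)).
Qed.

Lemma order_ge0 f : order_ge 0 f.
Proof. by move=> K; rewrite ltn0. Qed.

Lemma order_ge_moyal_term n a b f h : order_ge a f -> order_ge b h ->
  order_ge (n + (a + b)) (moyal_term n f h).
Proof.
elim: n f h => [|n IH] f h fa hb; first by rewrite add0n; exact: order_ge_ps_mul.
move=> K ltK; rewrite moyal_termS moyal_alg_sumE big1 // => m _.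
have IHm := IH _ _ (order_ge_partial m.1 fa) (order_ge_partial m.2 hb).
rewrite /poisson_mul moyal_algZE (order_ge_ps_mul (@order_ge_theta _ _) IHm) //.
exact: scaler0.
Qed.

(** The definition truncates the series at a length depending on K; any longer
    truncation gives the same coefficient, so one length serves for all the
    coefficients below a given degree. *)
Lemma moyal_mulE N f h K : (theta_deg K < N)%N ->
  moyal_mul f h K = \sum_(n < N) (n`!%:R)^-1 *: moyal_term n f h K.
Proof.
move=> ltK; rewrite /moyal_mul.
rewrite (big_ord_widen_cond N xpredT (fun n => (n`!%:R)^-1 *: moyal_term n f h K)) //.
rewrite big_mkcond; apply: eq_bigr => n _; case: ltnP => // Kn.
rewrite (order_ge_moyal_term (order_ge0 f) (order_ge0 h)) ?scaler0 //.
by rewrite !addn0.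
Qed.

Lemma agree_below_moyal_mul N f h :
  agree_below N (moyal_mul f h) (\sum_(n < N) (n`!%:R)^-1 *: moyal_term n f h).
Proof. by move=> K ltK; rewrite moyal_alg_sumE (moyal_mulE _ _ ltK). Qed.

Lemma moyal_mulDl f g h : moyal_mul (f + g) h = moyal_mul f h + moyal_mul g h.
Proof.
apply/funext => K; rewrite moyal_algDE /moyal_mul -big_split.
by apply: eq_bigr => n _; rewrite moyal_termDl; exact: scalerDr.
Qed.

Lemma moyal_mulDr f g h : moyal_mul f (g + h) = moyal_mul f g + moyal_mul f h.
Proof.
apply/funext => K; rewrite moyal_algDE /moyal_mul -big_split.
by apply: eq_bigr => n _; rewrite moyal_termDr; exact: scalerDr.
Qed.

Lemma moyal_mulZl c f h : moyal_mul (c *: f) h = c *: moyal_mul f h.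
Proof.
apply/funext => K; rewrite moyal_algZE /moyal_mul scaler_sumr.
by apply: eq_bigr => n _; rewrite moyal_termZl moyal_algZE !scalerA mulrC.
Qed.

Lemma moyal_mulZr c f h : moyal_mul f (c *: h) = c *: moyal_mul f h.
Proof.
apply/funext => K; rewrite moyal_algZE /moyal_mul scaler_sumr.
by apply: eq_bigr => n _; rewrite moyal_termZr moyal_algZE !scalerA mulrC.
Qed.

Lemma partial_moyal_mul lam f h : partial lam (moyal_mul f h) =
  moyal_mul (partial lam f) h + moyal_mul f (partial lam h).
Proof.
have d0 : partial_smooth lam 0 = 0 :> smooth_fun R.
  exact: (congr1 (@^~ [ffun=> 0%N]) (partial0 lam)).
apply/funext => K; rewrite moyal_algDE /partial /moyal_mul.
rewrite (big_morph _ (partial_smoothD lam) d0) -big_split.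
apply: eq_bigr => n _; rewrite partial_smoothZ; apply: etrans (scalerDr _ _ _).
congr (_ *: _).
exact: (congr1 (@^~ K) (partial_moyal_term lam n f h)).
Qed.

Lemma moyal_term_suml n I (r : seq I) (F : I -> moyal_alg R) h :
  moyal_term n (\sum_(i <- r) F i) h = \sum_(i <- r) moyal_term n (F i) h.
Proof.
apply: (big_morph (fun f => moyal_term n f h)) => [f g|]; first exact: moyal_termDl.
by rewrite -[X in moyal_term n X h](scale0r (0 : moyal_alg R)) moyal_termZl scale0r.
Qed.

Lemma moyal_term_sumr n I (r : seq I) (F : I -> moyal_alg R) f :
  moyal_term n f (\sum_(i <- r) F i) = \sum_(i <- r) moyal_term n f (F i).
Proof.
apply: (big_morph (moyal_term n f)) => [g h|]; first exact: moyal_termDr.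
by rewrite -[X in moyal_term n f X](scale0r (0 : moyal_alg R)) moyal_termZr scale0r.
Qed.

(** exp U exp V = exp (U + V) for commuting U and V, in a single coefficient of a
    single value; the vanishing hypothesis turns the square of indices into the
    triangle on which the binomial theorem applies. *)
Lemma exp_sum_commuting (T : Type) (U V : (T -> moyal_alg R) -> T -> moyal_alg R)
    (F : T -> moyal_alg R) (t : T) K N :
  {morph U : G H / G + H} -> {morph V : G H / G + H} ->
  (forall G, U (V G) = V (U G)) ->
  (forall a b, (N <= a + b)%N -> iter a U (iter b V F) t K = 0) ->
  \sum_(a < N) \sum_(b < N)
     (a`!%:R)^-1 *: ((b`!%:R)^-1 *: iter a U (iter b V F) t K) =
  \sum_(n < N) (n`!%:R)^-1 *: iter n (fun G => U G + V G) F t K.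
Proof.
move=> UD VD UV G0.
rewrite (@sum_triangle _
   (fun a b => (a`!%:R)^-1 *: ((b`!%:R)^-1 *: iter a U (iter b V F) t K))); last first.
  by move=> a b /G0 ->; rewrite !scaler0.
apply: eq_bigr => n _; rewrite iter_binomial //.
rewrite (big_morph (fun G : T -> moyal_alg R => G t K) (id1 := 0) (op1 := +%R)) //.
rewrite scaler_sumr; apply: eq_bigr => j _.
have jn : (j <= n)%N by rewrite -ltnS.
have -> : (iter j U (iter (n - j) V F) *+ 'C(n, j)) t K =
          ('C(n, j)%:R : R[i]) *: iter j U (iter (n - j) V F) t K.
  rewrite scaler_nat; elim: 'C(n, j) => // k IH.
  by rewrite !mulrS -IH.
rewrite !scalerA; congr (_ *: _).
rewrite -(bin_fact jn) !natrM.
have nz k : (k`!%:R : R[i]) != 0 by rewrite pnatr_eq0 -lt0n fact_gt0.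
have bz : ('C(n, j)%:R : R[i]) != 0 by rewrite pnatr_eq0 -lt0n bin_gt0.
move: (nz j) (nz (n - j)%N) bz; move: ('C(n, j)%:R) (j`!%:R) ((n - j)`!%:R) => x y z.
by move=> y0 z0 x0; field; rewrite ?x0 ?y0 ?z0.
Qed.

Local Notation triple := (moyal_alg R * moyal_alg R * moyal_alg R)%type.

Lemma twist_sumD (u v : 'I_4 * 'I_4 -> triple -> triple) :
  {morph (fun F : triple -> moyal_alg R => twist u F + twist v F) : F G / F + G}.
Proof. by move=> F G; rewrite !twistD addrACA. Qed.

Lemma twist_sum_comm (u v w : 'I_4 * 'I_4 -> triple -> triple)
    (F : triple -> moyal_alg R) :
  (forall m m' t, u m (w m' t) = w m' (u m t)) ->
  (forall m m' t, v m (w m' t) = w m' (v m t)) ->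
  twist u (twist w F) + twist v (twist w F) = twist w (twist u F + twist v F).
Proof. by move=> uw vw; rewrite twistD (twist_comm _ uw) (twist_comm _ vw). Qed.

(** Both iterated products equal the exponential of P12 + P13 + P23 applied to
    the commutative triple product. *)
Lemma moyal_mulA f g h : moyal_mul (moyal_mul f g) h = moyal_mul f (moyal_mul g h).
Proof.
apply/funext => K; set N := (theta_deg K).+1.
have ltK : (theta_deg K < N)%N by [].
pose W (F : triple -> moyal_alg R) :=
  twist (@deriv12 R) F + twist (@deriv13 R) F + twist (@deriv23 R) F.
transitivity (\sum_(n < N) (n`!%:R)^-1 *: iter n W (@triple_mul R) (f, g, h) K).
  rewrite (moyal_mulE _ _ ltK).
  transitivity (\sum_(a < N) \sum_(b < N)
    (a`!%:R)^-1 *: ((b`!%:R)^-1 *: moyal_term a (moyal_term b f g) h K)).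
    apply: eq_bigr => a _; rewrite -scaler_sumr; congr (_ *: _).
    rewrite (agree_below_moyal_term a (agree_below_moyal_mul f g)
               (agree_below_refl h) ltK).
    rewrite moyal_term_suml moyal_alg_sumE; apply: eq_bigr => b _.
    by rewrite moyal_termZl.
  under eq_bigr => a _ do under eq_bigr => b _ do rewrite moyal_term_left.
  rewrite exp_sum_commuting.
  - have <- : (fun F => twist (@deriv13 R) F + twist (@deriv23 R) F +
                        twist (@deriv12 R) F) = W.
      by apply/funext => F; rewrite /W addrC addrA.
    by [].
  - exact: twist_sumD.
  - by move=> ? ?; exact: twistD.
  - move=> F; apply: twist_sum_comm => m m' t;
      by rewrite /deriv13 /deriv12 /deriv23 /= partial_comm.
  - move=> a b Nab; rewrite -moyal_term_left.
    have fg := order_ge_moyal_term (n := b) (order_ge0 f) (order_ge0 g).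
    by apply: (order_ge_moyal_term fg (order_ge0 h)); rewrite !addn0.
symmetry; rewrite (moyal_mulE _ _ ltK).
transitivity (\sum_(a < N) \sum_(b < N)
  (a`!%:R)^-1 *: ((b`!%:R)^-1 *: moyal_term a f (moyal_term b g h) K)).
  apply: eq_bigr => a _; rewrite -scaler_sumr; congr (_ *: _).
  rewrite (agree_below_moyal_term a (agree_below_refl f)
             (agree_below_moyal_mul g h) ltK).
  rewrite moyal_term_sumr moyal_alg_sumE; apply: eq_bigr => b _.
  by rewrite moyal_termZr.
under eq_bigr => a _ do under eq_bigr => b _ do rewrite moyal_term_right.
rewrite exp_sum_commuting //.
- exact: twist_sumD.
- by move=> ? ?; exact: twistD.
- move=> F; apply: twist_sum_comm => m m' t;
    by rewrite /deriv13 /deriv12 /deriv23 /= partial_comm.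
- move=> a b Nab; rewrite -moyal_term_right.
  have gh := order_ge_moyal_term (n := b) (order_ge0 g) (order_ge0 h).
  by apply: (order_ge_moyal_term (order_ge0 f) gh); rewrite add0n !addn0.
Qed.

End MoyalProductTheory.

(** * Identities in an algebra with commuting derivations *)

(** The scalar-valued linear functions ev separate the points of V, so that
    identities between linear combinations of noncommutative monomials can be
    decided by the ring tactic over the commutative scalars, one evaluation at a
    time, after the monomials have been replaced by variables. *)
Section DerivationAlgebra.
Variables (C : comNzRingType) (V : lmodType C) (I P : Type).
Variables (ev : P -> V -> C) (d : I -> V -> V) (mul : V -> V -> V).
Hypothesis evD : forall p x y, ev p (x + y) = ev p x + ev p y.
Hypothesis evZ : forall p c x, ev p (c *: x) = c * ev p x.
Hypothesis ev_inj : forall x y, (forall p, ev p x = ev p y) -> x = y.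
Hypothesis dD : forall i x y, d i (x + y) = d i x + d i y.
Hypothesis dZ : forall i c x, d i (c *: x) = c *: d i x.
Hypothesis dC : forall i j x, d i (d j x) = d j (d i x).
Hypothesis dM : forall i x y, d i (mul x y) = mul (d i x) y + mul x (d i y).
Hypothesis mulDl : forall x y z, mul (x + y) z = mul x z + mul y z.
Hypothesis mulDr : forall x y z, mul x (y + z) = mul x y + mul x z.
Hypothesis mulZl : forall c x y, mul (c *: x) y = c *: mul x y.
Hypothesis mulZr : forall c x y, mul x (c *: y) = c *: mul x y.

Let evN p x : ev p (- x) = - ev p x.
Proof. by rewrite -scaleN1r evZ mulN1r. Qed.

Let dN i x : d i (- x) = - d i x.
Proof. by rewrite -scaleN1r dZ scaleN1r. Qed.

Let mulNl x y : mul (- x) y = - mul x y.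
Proof. by rewrite -scaleN1r mulZl scaleN1r. Qed.

Let mulNr x y : mul x (- y) = - mul x y.
Proof. by rewrite -scaleN1r mulZr scaleN1r. Qed.

Let expandE := (dD, dN, dZ, dM, mulDl, mulDr, mulNl, mulNr, mulZl, mulZr).

Local Notation "[ x ; y ]" := (mul x y - mul y x).

Ltac by_evaluation :=
  apply: ev_inj => p; rewrite !(evD, evN, evZ);
  repeat match goal with |- context [ev ?p ?x] => generalize (ev p x) end;
  intros; ring.

(** The derivatives of the curl cancel, and the Leibniz rule regroups those of
    the commutators into commutators with the curl. *)
Lemma derivation_gauss (c : C) i j k x y z :
  let Bx := d j z - d k y in
  let By := d k x - d i z in
  let Bz := d i y - d j x in
  d i (Bx + c *: [y ; z]) + d j (By + c *: [z ; x]) + d k (Bz + c *: [x ; y]) =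
  c *: ([Bx ; x] + [By ; y] + [Bz ; z]).
Proof. by rewrite /= !expandE (dC k i) (dC j i) (dC k j); by_evaluation. Qed.

(** One component of the Faraday equation, t being the time index. *)
Lemma derivation_faraday (c : C) t j k phi y z :
  let Ey := - d t y - d j phi in
  let Ez := - d t z - d k phi in
  let Bx := d j z - d k y in
  d j (Ez + c *: [phi ; z]) - d k (Ey + c *: [phi ; y]) + d t (Bx + c *: [y ; z]) =
  c *: [phi ; Bx] - c *: ((mul Ey z - mul Ez y) + (mul y Ez - mul z Ey)).
Proof. by rewrite /= !expandE (dC t j) (dC t k) (dC k j); by_evaluation. Qed.

Hypothesis mulA : forall x y z, mul (mul x y) z = mul x (mul y z).

(** Associativity enters through the cubic terms: they form the cyclic sum of
    [x, [y, z]], which vanishes by the Jacobi identity. *)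
Lemma derivation_bianchi (c : C) i j k x y z :
  let Fij := d i y - d j x - c *: [x ; y] in
  let Fik := d i z - d k x - c *: [x ; z] in
  let Fjk := d j z - d k y - c *: [y ; z] in
  d i Fjk - d j Fik + d k Fij =
  c *: ((mul x Fjk - mul y Fik + mul z Fij) - (mul Fjk x - mul Fik y + mul Fij z)).
Proof. by rewrite /= !expandE !mulA (dC k i) (dC j i) (dC k j); by_evaluation. Qed.

End DerivationAlgebra.

(** * Coefficients of forms *)

Section Components.
Context {R : realType}.
Implicit Types (i j k mu : 'I_4) (S B : {set 'I_4}).

(** Coefficients indexed by all sets, with value 0 at sets of the wrong size:
    indices such as S :\ mu can then be written without a cardinality proof. *)
Definition form_coef n (a : Omega R n) S : moyal_alg R :=
  if (insub S : option (form_idx n)) is Some J then a J else 0.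

Lemma form_coef_val n (a : Omega R n) (I : form_idx n) :
  form_coef a (val I) = a I.
Proof. by rewrite /form_coef valK. Qed.

Lemma form_coefD n (a b : Omega R n) S :
  form_coef (a + b) S = form_coef a S + form_coef b S.
Proof. by rewrite /form_coef; case: insub => //; rewrite addr0. Qed.

Lemma form_coefN n (a : Omega R n) S : form_coef (- a) S = - form_coef a S.
Proof. by rewrite /form_coef; case: insub => //; rewrite oppr0. Qed.

Lemma form_coefZ n c (a : Omega R n) S :
  form_coef (c *: a) S = c *: form_coef a S.
Proof. by rewrite /form_coef; case: insub => //; rewrite scaler0. Qed.

Lemma form_coef_sum n I (r : seq I) (a : I -> Omega R n) S :
  form_coef (\sum_(x <- r) a x) S = \sum_(x <- r) form_coef (a x) S.
Proof.
apply: (big_morph (form_coef (n := n) ^~ S)) => [a1 a2|]; first exact: form_coefD.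
by rewrite /form_coef; case: insub.
Qed.

Lemma form_coef_monomial n f B S : #|S| == n ->
  form_coef (@monomial_form R n f B) S = if S == B then f else 0.
Proof. by move=> cS; rewrite /form_coef insubT. Qed.

Lemma sum_form_idx1 (G : {set 'I_4} -> moyal_alg R) :
  \sum_(I : form_idx 1) G (val I) = \sum_mu G [set mu].
Proof.
have c1 mu : #|[set mu]| == 1%N by rewrite cards1.
rewrite (reindex (fun mu => exist _ [set mu] (c1 mu) : form_idx 1)) //.
apply: onW_bij; have pickP (I : form_idx 1) : exists mu, val I == [set mu].
  by have /cards1P [mu ->] := valP I; exists mu.
exists (fun I => xchoose (pickP I)) => [mu|I].
  by apply: finset.set1_inj; apply/esym/eqP; exact: (xchooseP (pickP _)).
by apply: val_inj; apply/esym/eqP; exact: (xchooseP (pickP I)).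
Qed.

(** In a product with dx^B, the coefficient at S only involves the complement of
    B in S. *)
Lemma sum_complement l B S (G : {set 'I_4} -> moyal_alg R) : #|S| = (#|B| + l)%N ->
  \sum_(J : form_idx l | [disjoint B & val J] && (B :|: val J == S)) G (val J) =
  if B \subset S then G (S :\: B) else 0.
Proof.
move=> cS; case: ifP => [BS|BS]; last first.
  rewrite big1 // => J /andP[_ /eqP SE].
  by rewrite -SE finset.subsetUl in BS.
have cD : #|S :\: B| == l by rewrite cardsD (finset.setIidPr BS) cS addKn.
have [D vD] : exists D : form_idx l, val D = S :\: B
  by exists (exist (fun B' : {set 'I_4} => #|B'| == l) _ cD).
rewrite -vD (big_pred1 D) // => J; apply/andP/eqP => [[dBJ /eqP SE]|->].
  apply: val_inj; rewrite vD -SE finset.setDUl finset.setDv finset.set0U.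
  by apply/esym/finset.setDidPl; rewrite disjoint_sym.
rewrite vD; split; first by
  rewrite disjoint_sym finset.disjoints_subset finset.subsetDr.
rewrite finset.setDE finset.setUIr finset.setUCr finset.setIT.
exact/eqP/finset.setUidPr.
Qed.

Lemma form_coef_wedge1l l (a : Omega R 1) (b : Omega R l) S : #|S| = l.+1 ->
  form_coef (wedge a b) S = \sum_(mu in S) shuffle_sign [set mu] (S :\ mu) *:
    moyal_mul (form_coef a [set mu]) (form_coef b (S :\ mu)).
Proof.
move=> cS; have cS' : #|S| == (1 + l)%N by rewrite cS.
have -> : form_coef (wedge a b) S =
    \sum_(I : form_idx 1) \sum_(J : form_idx l |
       [disjoint val I & val J] && (val I :|: val J == S))
      shuffle_sign (val I) (val J) *:
        moyal_mul (form_coef a (val I)) (form_coef b (val J)).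
  rewrite /form_coef insubT; apply: eq_bigr => I _; apply: eq_bigr => J _.
  by rewrite !valK.
rewrite (sum_form_idx1 (fun B => \sum_(J : form_idx l |
       [disjoint B & val J] && (B :|: val J == S))
      shuffle_sign B (val J) *: moyal_mul (form_coef a B) (form_coef b (val J)))).
rewrite [RHS]big_mkcond; apply: eq_bigr => mu _.
rewrite (sum_complement (fun B => shuffle_sign [set mu] B *:
  moyal_mul (form_coef a [set mu]) (form_coef b B))) ?cards1 //.
by rewrite finset.sub1set.
Qed.

Lemma form_coef_wedge1r l (b : Omega R l) (a : Omega R 1) S : #|S| = l.+1 ->
  form_coef (wedge b a) S = \sum_(mu in S) shuffle_sign (S :\ mu) [set mu] *:
    moyal_mul (form_coef b (S :\ mu)) (form_coef a [set mu]).
Proof.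
move=> cS; have cS' : #|S| == (l + 1)%N by rewrite cS addn1.
have -> : form_coef (wedge b a) S =
    \sum_(I : form_idx 1) \sum_(J : form_idx l |
       [disjoint val I & val J] && (val I :|: val J == S))
      shuffle_sign (val J) (val I) *:
        moyal_mul (form_coef b (val J)) (form_coef a (val I)).
  rewrite /form_coef insubT /wedge (exchange_big_dep xpredT) //=.
  apply: eq_bigr => I _; apply: eq_big => [J|J _]; last by rewrite !valK.
  by rewrite disjoint_sym finset.setUC.
rewrite (sum_form_idx1 (fun B => \sum_(J : form_idx l |
       [disjoint B & val J] && (B :|: val J == S))
      shuffle_sign (val J) B *: moyal_mul (form_coef b (val J)) (form_coef a B))).
rewrite [RHS]big_mkcond; apply: eq_bigr => mu _.
rewrite (sum_complement (fun B => shuffle_sign B [set mu] *: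
  moyal_mul (form_coef b B) (form_coef a [set mu]))) ?cards1 //.
by rewrite finset.sub1set.
Qed.

Lemma form_coef_ext_d n (a : Omega R n) S : #|S| = n.+1 ->
  form_coef (ext_d a) S = \sum_(mu in S) shuffle_sign [set mu] (S :\ mu) *:
    partial mu (form_coef a (S :\ mu)).
Proof.
move=> cS; have cS' : #|S| == n.+1 by rewrite cS.
have -> : form_coef (ext_d a) S =
    \sum_mu \sum_(J : form_idx n |
       [disjoint [set mu] & val J] && ([set mu] :|: val J == S))
      shuffle_sign [set mu] (val J) *: partial mu (form_coef a (val J)).
  rewrite /form_coef insubT /ext_d; apply: eq_bigr => mu _.
  apply: eq_big => [J|J _]; last by rewrite !valK.
  by rewrite finset.disjoints1.
rewrite [RHS]big_mkcond; apply: eq_bigr => mu _.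
rewrite (sum_complement (fun B => shuffle_sign [set mu] B *:
  partial mu (form_coef a B))) ?cards1 //.
by rewrite finset.sub1set.
Qed.

Lemma shuffle_sign1l mu B :
  shuffle_sign [set mu] B = (-1) ^+ (\sum_(x in B) (x < mu)%N) :> R[i].
Proof.
rewrite /shuffle_sign; congr (_ ^+ _).
transitivity #|[set (mu, x) | x in B & (x < mu)%N]|; last first.
  rewrite card_in_imset => [|x y _ _ []] //.
  rewrite -sum1_card; under eq_bigl => x do rewrite inE.
  rewrite big_mkcondr; apply: eq_bigr => x _.
  by case: (_ < _)%N.
apply: eq_card => -[p q]; rewrite inE /= finset.in_set1.
apply/and3P/imsetP => [[/eqP -> qB qmu]|[x]].
  by exists q; rewrite // inE qB.
by rewrite inE => /andP[xB xmu] [-> ->].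
Qed.

Lemma shuffle_sign1r mu B :
  shuffle_sign B [set mu] = (-1) ^+ (\sum_(x in B) (mu < x)%N) :> R[i].
Proof.
rewrite /shuffle_sign; congr (_ ^+ _).
transitivity #|[set (x, mu) | x in B & (mu < x)%N]|; last first.
  rewrite card_in_imset => [|x y _ _ []] //.
  rewrite -sum1_card; under eq_bigl => x do rewrite inE.
  rewrite big_mkcondr; apply: eq_bigr => x _.
  by case: (_ < _)%N.
apply: eq_card => -[p q]; rewrite inE /= finset.in_set1.
apply/and3P/imsetP => [[pB /eqP -> pmu]|[x]].
  by exists p; rewrite // inE pB.
by rewrite inE => /andP[xB xmu] [-> ->].
Qed.

Lemma sum_set2 (V : nmodType) i j (F : 'I_4 -> V) : (i < j)%N ->
  \sum_(x in [set i; j]) F x = F i + F j.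
Proof.
move=> ij; rewrite big_setU1 ?big_set1 //= finset.in_set1.
by rewrite -val_eqE ltn_eqF.
Qed.

Lemma sum_set3 (V : nmodType) i j k (F : 'I_4 -> V) : (i < j < k)%N ->
  \sum_(x in [set i; j; k]) F x = F i + F j + F k.
Proof.
move=> /andP[ij jk]; rewrite -finset.setUA big_setU1 /=.
  by rewrite sum_set2 // addrA.
by rewrite !inE -!val_eqE /= !ltn_eqF // (ltn_trans ij).
Qed.

Lemma setD_pair i j : (i < j)%N ->
  ([set i; j] :\ i = [set j]) * ([set i; j] :\ j = [set i]).
Proof.
move=> ij; split; apply/finset.setP => x; rewrite !inE -!val_eqE /=; lia.
Qed.

Lemma setD_triple i j k : (i < j < k)%N ->
  (([set i; j; k] :\ i = [set j; k]) * ([set i; j; k] :\ j = [set i; k]) *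
   ([set i; j; k] :\ k = [set i; j]))%type.
Proof.
move=> ijk; repeat split; apply/finset.setP => x; rewrite !inE -!val_eqE /=; lia.
Qed.

Lemma card_triple i j k : (i < j < k)%N -> #|[set i; j; k]| = 3%N.
Proof. by move=> ijk; rewrite -sum1_card sum_set3. Qed.

Lemma card_pair i j : (i < j)%N -> #|[set i; j]| = 2%N.
Proof. by move=> ij; rewrite -sum1_card sum_set2. Qed.

End Components.

(** * Forms of degree at most three *)

Section LowDegree.
Context {R : realType}.
Implicit Types (i j k mu : 'I_4) (a b : Omega R 1) (F : Omega R 2).

Lemma form_coef_wedge11 a b i j : (i < j)%N -> form_coef (wedge a b) [set i; j] =
  moyal_mul (form_coef a [set i]) (form_coef b [set j]) -
  moyal_mul (form_coef a [set j]) (form_coef b [set i]).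
Proof.
move=> ij; rewrite form_coef_wedge1l ?card_pair // sum_set2 // !(setD_pair ij).
rewrite !shuffle_sign1l !big_set1 ij ltnNge (ltnW ij).
by rewrite expr0 expr1 scale1r scaleN1r.
Qed.

Lemma form_coef_ext_d1 a i j : (i < j)%N -> form_coef (ext_d a) [set i; j] =
  partial i (form_coef a [set j]) - partial j (form_coef a [set i]).
Proof.
move=> ij; rewrite form_coef_ext_d ?card_pair // sum_set2 // !(setD_pair ij).
rewrite !shuffle_sign1l !big_set1 ij ltnNge (ltnW ij).
by rewrite expr0 expr1 scale1r scaleN1r.
Qed.

Lemma form_coef_ext_d2 F i j k : (i < j < k)%N -> form_coef (ext_d F) [set i; j; k] =
  partial i (form_coef F [set j; k]) - partial j (form_coef F [set i; k]) +
  partial k (form_coef F [set i; j]).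
Proof.
move=> ijk; have /andP[ij jk] := ijk; have ik := ltn_trans ij jk.
rewrite form_coef_ext_d ?card_triple // sum_set3 // !(setD_triple ijk).
rewrite !shuffle_sign1l !sum_set2 // ij ik jk !(ltnNge _ i) !(ltnNge k).
rewrite (ltnW ij) (ltnW ik) (ltnW jk).
by rewrite /= ?add0n ?addn0 ?addn1 expr0 expr1 sqrrN expr1n !scale1r scaleN1r.
Qed.

Lemma form_coef_wedge12 a F i j k : (i < j < k)%N ->
  form_coef (wedge a F : Omega R 3) [set i; j; k] =
  moyal_mul (form_coef a [set i]) (form_coef F [set j; k]) -
  moyal_mul (form_coef a [set j]) (form_coef F [set i; k]) +
  moyal_mul (form_coef a [set k]) (form_coef F [set i; j]).
Proof.
move=> ijk; have /andP[ij jk] := ijk; have ik := ltn_trans ij jk.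
rewrite -[LHS]/(@form_coef R (1 + 2) (wedge a F) [set i; j; k]).
rewrite form_coef_wedge1l ?card_triple // sum_set3 // !(setD_triple ijk).
rewrite !shuffle_sign1l !sum_set2 // ij ik jk !(ltnNge _ i) !(ltnNge k).
rewrite (ltnW ij) (ltnW ik) (ltnW jk).
by rewrite /= ?add0n ?addn0 ?addn1 expr0 expr1 sqrrN expr1n !scale1r scaleN1r.
Qed.

Lemma form_coef_wedge21 F a i j k : (i < j < k)%N ->
  form_coef (wedge F a : Omega R 3) [set i; j; k] =
  moyal_mul (form_coef F [set j; k]) (form_coef a [set i]) -
  moyal_mul (form_coef F [set i; k]) (form_coef a [set j]) +
  moyal_mul (form_coef F [set i; j]) (form_coef a [set k]).
Proof.
move=> ijk; have /andP[ij jk] := ijk; have ik := ltn_trans ij jk.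
rewrite -[LHS]/(@form_coef R (2 + 1) (wedge F a) [set i; j; k]).
rewrite form_coef_wedge1r ?card_triple // sum_set3 // !(setD_triple ijk).
rewrite !shuffle_sign1r !sum_set2 // ij ik jk !(ltnNge _ i) !(ltnNge k).
rewrite (ltnW ij) (ltnW ik) (ltnW jk).
by rewrite /= ?add0n ?addn0 ?addn1 expr0 expr1 sqrrN expr1n !scale1r scaleN1r.
Qed.

Lemma form_coef_wedge_comm a F i j k : (i < j < k)%N ->
  form_coef (wedge a F - wedge F a : Omega R 3) [set i; j; k] =
  (moyal_mul (form_coef a [set i]) (form_coef F [set j; k]) -
   moyal_mul (form_coef a [set j]) (form_coef F [set i; k]) +
   moyal_mul (form_coef a [set k]) (form_coef F [set i; j])) -
  (moyal_mul (form_coef F [set j; k]) (form_coef a [set i]) -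
   moyal_mul (form_coef F [set i; k]) (form_coef a [set j]) +
   moyal_mul (form_coef F [set i; j]) (form_coef a [set k])).
Proof.
by move=> ijk; rewrite form_coefD form_coefN form_coef_wedge12 // form_coef_wedge21.
Qed.

Lemma form_coef_field_strength a i j : (i < j)%N ->
  form_coef (field_strength a) [set i; j] =
  partial i (form_coef a [set j]) - partial j (form_coef a [set i]) -
  'i *: moyal_comm (form_coef a [set i]) (form_coef a [set j]).
Proof.
move=> ij; rewrite form_coefD form_coefN form_coefZ.
by rewrite form_coef_ext_d1 // form_coef_wedge11.
Qed.

(** A three-element set of indices is determined by the missing index. *)
Lemma triple_setC :
  ([set 1; 2; 3] = ~: [set 0] :> {set 'I_4}) *
  ([set 0; 2; 3] = ~: [set 1] :> {set 'I_4}) *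
  ([set 0; 1; 3] = ~: [set 2] :> {set 'I_4}) *
  ([set 0; 1; 2] = ~: [set 3] :> {set 'I_4}).
Proof.
have v1 : val (1 : 'I_4) = 1%N by [].
have v2 : val (2 : 'I_4) = 2%N by [].
have v3 : val (3 : 'I_4) = 3%N by [].
by repeat split; apply/finset.setP => x; rewrite !inE -!val_eqE ?v1 ?v2 ?v3 /=;
  have := ltn_ord x; lia.
Qed.

Lemma ord4P (m : 'I_4) : [\/ m = 0, m = 1, m = 2 | m = 3].
Proof.
by case: m => -[|[|[|[|//]]]] lt;
  [apply: Or41|apply: Or42|apply: Or43|apply: Or44]; apply: val_inj.
Qed.

Lemma three_form_ext (W W' : Omega R 3) :
  form_coef W [set 1; 2; 3] = form_coef W' [set 1; 2; 3] ->
  form_coef W [set 0; 2; 3] = form_coef W' [set 0; 2; 3] ->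
  form_coef W [set 0; 1; 3] = form_coef W' [set 0; 1; 3] ->
  form_coef W [set 0; 1; 2] = form_coef W' [set 0; 1; 2] -> W = W'.
Proof.
rewrite !triple_setC => e0 e1 e2 e3; apply/funext => J; rewrite -!form_coef_val.
have /cards1P [m cJ] : #|~: val J| == 1%N.
  by rewrite cardsCs finset.setCK card_ord (eqP (valP J)).
by rewrite -[val J]finset.setCK cJ; case: (ord4P m) => ->.
Qed.

End LowDegree.

(** * Linearity of the operations, and evaluation at a point *)

Section Evaluation.
Context {R : realType}.
Implicit Types (mu : 'I_4).

(** The value at a point of the coefficient of one theta-monomial. *)
Definition eval_at (p : theta_exp * 'rV[R]_4) (f : moyal_alg R) : R[i] := f p.1 p.2.

Lemma eval_atD p f g : eval_at p (f + g) = eval_at p f + eval_at p g.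
Proof. by []. Qed.

Lemma eval_atZ p c f : eval_at p (c *: f) = c * eval_at p f.
Proof. by []. Qed.

Lemma eval_at_inj f g : (forall p, eval_at p f = eval_at p g) -> f = g.
Proof.
move=> fg; apply/funext => K; apply: smooth_fun_ext => x.
exact: (fg (K, x)).
Qed.

Lemma partialN mu f : partial mu (- f) = - partial mu f :> moyal_alg R.
Proof. by rewrite -scaleN1r partialZ scaleN1r. Qed.

Lemma moyal_mulNl (f h : moyal_alg R) : moyal_mul (- f) h = - moyal_mul f h.
Proof. by rewrite -scaleN1r moyal_mulZl scaleN1r. Qed.

Lemma moyal_mulNr (f h : moyal_alg R) : moyal_mul f (- h) = - moyal_mul f h.
Proof. by rewrite -scaleN1r moyal_mulZr scaleN1r. Qed.

Lemma moyal_commNr (f h : moyal_alg R) : moyal_comm f (- h) = - moyal_comm f h.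
Proof. by rewrite /moyal_comm moyal_mulNr moyal_mulNl -opprD. Qed.

Lemma moyal_commNl (f h : moyal_alg R) : moyal_comm (- f) h = - moyal_comm f h.
Proof. by rewrite /moyal_comm moyal_mulNr moyal_mulNl -opprD. Qed.

End Evaluation.

(** * The field equations *)

Section FieldEquations.
Context {R : realType}.
Implicit Types (a : Omega R 1) (phi : moyal_alg R) (A : 'I_3 -> moyal_alg R).

Let moyal_bianchi := derivation_bianchi (@eval_atD R) (@eval_atZ R) (@eval_at_inj R)
  partialD partialZ partial_comm partial_moyal_mul
  moyal_mulDl moyal_mulDr moyal_mulZl moyal_mulZr moyal_mulA.

Let moyal_gauss := derivation_gauss (@eval_atD R) (@eval_atZ R) (@eval_at_inj R)
  partialD partialZ partial_comm partial_moyal_mul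
  moyal_mulDl moyal_mulDr moyal_mulZl moyal_mulZr.

Let moyal_faraday := derivation_faraday (@eval_atD R) (@eval_atZ R) (@eval_at_inj R)
  partialD partialZ partial_comm partial_moyal_mul
  moyal_mulDl moyal_mulDr moyal_mulZl moyal_mulZr.

Lemma bianchi_identity a : ext_d (field_strength a) =
  'i *: (wedge a (field_strength a) - wedge (field_strength a) a) :> Omega R 3.
Proof.
have bianchi_coef (i j k : 'I_4) : (i < j < k)%N ->
    form_coef (ext_d (field_strength a)) [set i; j; k] =
    form_coef ('i *: (wedge a (field_strength a) - wedge (field_strength a) a)
               : Omega R 3) [set i; j; k].
  move=> ijk; have /andP[ij jk] := ijk; have ik := ltn_trans ij jk.
  rewrite form_coef_ext_d2 // form_coefZ form_coef_wedge_comm //.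
  rewrite (form_coef_field_strength a ij) (form_coef_field_strength a ik).
  rewrite (form_coef_field_strength a jk).
  exact: moyal_bianchi.
by apply: three_form_ext; exact: bianchi_coef.
Qed.

Lemma form_coef_potential_time phi A : form_coef (potential_form phi A) [set 0] = phi.
Proof.
rewrite /potential_form form_coefD form_coefN form_coef_sum.
rewrite form_coef_monomial ?cards1 // eqxx big1 ?subr0 // => j _.
rewrite form_coef_monomial ?cards1 // (inj_eq finset.set1_inj).
by rewrite (negPf (neq_lift _ _)).
Qed.

Lemma form_coef_potential_space phi A j :
  form_coef (potential_form phi A) [set space_idx j] = - A j.
Proof.
rewrite /potential_form form_coefD form_coefN form_coef_sum.
rewrite form_coef_monomial ?cards1 // (inj_eq finset.set1_inj) eq_sym.
rewrite (negPf (neq_lift _ _)) add0r (bigD1 j) //= big1 ?addr0 => [|k kj].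
  by rewrite form_coef_monomial ?cards1 // eqxx.
rewrite form_coef_monomial ?cards1 // (inj_eq finset.set1_inj) (inj_eq lift_inj).
by rewrite eq_sym (negPf kj).
Qed.

Lemma form_coef_electric phi A j :
  form_coef (field_strength (potential_form phi A)) [set 0; space_idx j] =
  D_field phi A j.
Proof.
rewrite form_coef_field_strength // form_coef_potential_time form_coef_potential_space.
by rewrite partialN moyal_commNr scalerN opprK.
Qed.

Lemma form_coef_magnetic phi A (j k : 'I_3) : (j < k)%N ->
  form_coef (field_strength (potential_form phi A)) [set space_idx j; space_idx k] =
  - (partial (space_idx j) (A k) - partial (space_idx k) (A j) +
     'i *: moyal_comm (A j) (A k)).
Proof.
move=> jk; rewrite form_coef_field_strength // !form_coef_potential_space.
rewrite !partialN moyal_commNl moyal_commNr opprK.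
by rewrite !opprD !opprK.
Qed.

Lemma form_coef_three_form f (V : 'I_3 -> moyal_alg R) :
  [/\ form_coef (three_form f V) [set 1; 2; 3] = f,
      form_coef (three_form f V) [set 0; 2; 3] = V 0,
      form_coef (three_form f V) [set 0; 1; 3] = - V 1 &
      form_coef (three_form f V) [set 0; 1; 2] = V 2].
Proof.
have cC (m : 'I_4) : #|~: [set m]| == 3%N.
  by rewrite cardsC1 card_ord.
have compl_eq (m n : 'I_4) : (~: [set m] == ~: [set n]) = (m == n).
  by rewrite (inj_eq (can_inj (@finset.setCK _))) (inj_eq finset.set1_inj).
rewrite /three_form !triple_setC; split;
  rewrite !form_coefD form_coefN !form_coef_monomial ?cC // !compl_eq /=.
- by rewrite !addr0 oppr0 addr0.
- by rewrite !addr0 oppr0 addr0 add0r.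
- by rewrite !add0r addr0.
- by rewrite oppr0 !add0r.
Qed.

Lemma sum_ord3 (V : nmodType) (F : 'I_3 -> V) : \sum_j F j = F 0 + F 1 + F 2.
Proof.
rewrite !big_ord_recl big_ord0 addr0 addrA.
by congr (F _ + F _ + F _); apply: val_inj.
Qed.

Lemma ord3_add :
  (1 + 1 = 2 :> 'I_3) * (1 + 2 = 0 :> 'I_3) * (2 + 1 = 0 :> 'I_3) * (2 + 2 = 1 :> 'I_3).
Proof. by repeat split; apply: val_inj. Qed.

Lemma space_idxE : (space_idx 0 = 1) * (space_idx 1 = 2) * (space_idx 2 = 3).
Proof. by repeat split; apply: val_inj. Qed.

(** The indices k and l stand for j + 1 and j + 2 modulo 3 so that a given
    component can be written with the reduced indices. *)
Lemma H_fieldE A j k l : j + 1 = k -> j + 2 = l -> H_field A j =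
  partial (space_idx k) (A l) - partial (space_idx l) (A k) +
    'i *: moyal_comm (A k) (A l).
Proof. by move=> <- <-. Qed.

Lemma B_fieldE A j k l : j + 1 = k -> j + 2 = l -> B_field A j =
  partial (space_idx k) (A l) - partial (space_idx l) (A k).
Proof. by move=> <- <-. Qed.

Lemma gauss_magnetic A : divergence (H_field A) = magnetic_charge A.
Proof.
rewrite /divergence /magnetic_charge /comm_vec !sum_ord3.
have idx := ord3_add.
rewrite (@H_fieldE A 0 1 2) ?add0r // (@H_fieldE A 1 2 0) ?idx //.
rewrite (@H_fieldE A 2 0 1) ?idx //.
rewrite (@B_fieldE A 0 1 2) ?add0r // (@B_fieldE A 1 2 0) ?idx //.
rewrite (@B_fieldE A 2 0 1) ?idx //; exact: moyal_gauss.
Qed.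

Lemma faraday phi A :
  curl (D_field phi A) + time_deriv (H_field A) = - magnetic_current phi A.
Proof.
apply/funext => j; rewrite /magnetic_current opprK.
exact: moyal_faraday.
Qed.

(** dF is linear in the coefficients of F, which are the components of D and H
    up to sign. *)
Lemma ext_d_field_strength phi A :
  ext_d (field_strength (potential_form phi A)) =
  - three_form (divergence (H_field A)) (curl (D_field phi A) + time_deriv (H_field A)).
Proof.
have idx := ord3_add.
set F := field_strength _.
have F0 := form_coef_electric phi A; rewrite -/F in F0.
have FH := form_coef_magnetic phi A; rewrite -/F in FH.
have F23 : form_coef F [set space_idx 1; space_idx 2] = - H_field A 0.
  by rewrite (FH 1 2 isT) (@H_fieldE A 0 1 2) ?add0r.
have F12 : form_coef F [set space_idx 0; space_idx 1] = - H_field A 2.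
  by rewrite (FH 0 1 isT) (@H_fieldE A 2 0 1) ?idx.
have F13 : form_coef F [set space_idx 0; space_idx 2] = H_field A 1.
  (* The order 0 < 2 reverses the cyclic order, hence no sign here. *)
  rewrite (FH 0 2 isT) (@H_fieldE A 1 2 0) ?idx // opprD opprB -scalerN.
  by rewrite /moyal_comm opprB.
rewrite !space_idxE in F23 F12 F13.
have F01 := F0 0; have F02 := F0 1; have F03 := F0 2.
rewrite !space_idxE in F01 F02 F03.
have [T0 T1 T2 T3] := form_coef_three_form (divergence (H_field A))
   (curl (D_field phi A) + time_deriv (H_field A)).
have curlE j k l : j + 1 = k -> j + 2 = l ->
    (curl (D_field phi A) + time_deriv (H_field A)) j =
    partial (space_idx k) (D_field phi A l) - partial (space_idx l) (D_field phi A k)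
    + partial 0 (H_field A j).
  by move=> <- <-.
apply: three_form_ext; rewrite form_coefN form_coef_ext_d2 //.
- rewrite T0 F23 F13 F12 /divergence sum_ord3 !space_idxE !partialN.
  by rewrite !opprD.
- rewrite T1 F23 F03 F02 partialN (curlE 0 1 2) ?add0r // !space_idxE.
  by rewrite !opprD opprK addrC addrA addrAC [- _ + _]addrC.
- rewrite T2 F13 F03 F01 opprK (curlE 1 2 0) ?idx // !space_idxE.
  by rewrite addrC addrA addrAC.
- rewrite T3 F12 F02 F01 partialN (curlE 2 0 1) ?idx // !space_idxE.
  by rewrite !opprD opprK addrC addrA addrAC [- _ + _]addrC.
Qed.

End FieldEquations.

Theorem theorem3p2 (R : realType)
  (invGamma : vectType R[i]) (vartheta : invGamma)
  (vartheta_basis : basis_of fullv [:: vartheta])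
  (phi : moyal_alg R) (A : 'I_3 -> moyal_alg R)
  (Aomega : {linear invGamma -> Omega R 1})
  (Aomega_vartheta : Aomega vartheta = potential_form phi A) :
  let a : Omega R 1 := Aomega vartheta in
  let F : Omega R 2 := field_strength a in
  let D := D_field phi A in
  let H := H_field A in
  let rho_m := magnetic_charge A in
  let j_m := magnetic_current phi A in
  let bianchi_lhs : Omega R 3 := ext_d F in
  let bianchi_rhs : Omega R 3 := 'i *: (wedge a F - wedge F a) in
  [/\ bianchi_lhs = bianchi_rhs,
      bianchi_lhs = - three_form (divergence H) (curl D + time_deriv H),
      bianchi_rhs = - three_form rho_m (- j_m) &
      bianchi_lhs = bianchi_rhs <->
        divergence H = rho_m /\ curl D + time_deriv H = - j_m].
Proof.
move=> a F D H rho_m j_m lhs rhs.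
have bianchi : lhs = rhs := bianchi_identity a.
have lhsE : lhs = - three_form (divergence H) (curl D + time_deriv H).
  by rewrite /lhs /F /a Aomega_vartheta; exact: ext_d_field_strength.
have gauss : divergence H = rho_m := gauss_magnetic A.
have far : curl D + time_deriv H = - j_m := faraday phi A.
by split=> //; rewrite -bianchi lhsE gauss far.
Qed.
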